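(* Let $k$ be a field, $I$ an ideal of $k[y_1,\ldots,y_m,x_1,\ldots,x_n]$, $J=I\cap k[y_1,\ldots,y_m]$, $B=k[y_1,\ldots,y_m,x_1,\ldots,x_n]/I$ and $A=k[y_1,\ldots,y_m]/J$. Suppose $\{g_1,\ldots,g_t\}$ is a set of generators of $I$. Define the $n\times t$ matrix $\mathcal{J}=\left(\frac{\partial g_j}{\partial x_i}\right)_{1\le i\le n,\,1\le j\le t}$, and let $\mathrm{Jac}(B)\subseteq k[y_1,\ldots,y_m,x_1,\ldots,x_n]$ be the ideal generated by all $n$-minors of $\mathcal{J}$ plus $I$. Then the largest open subset of $\operatorname{Spec}A$ over which the morphism $\operatorname{Spec}B\to\operatorname{Spec}A$ is finite étale is the complement of $$W\cup V(F)\cup V\bigl(\mathrm{Jac}(B)\cap k[y_1,\ldots,y_m]\bigr),$$ where $W\subseteq\operatorname{Spec}A$ is the non-finite locus and $F$ is the flatness ideal, both defined in the context.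
   Context: Write $\boldsymbol{y}=(y_1,\ldots,y_m)$, $\boldsymbol{x}=(x_1,\ldots,x_n)$. $T_x,T_y$ are monomial orders in $\boldsymbol{x}$ and $\boldsymbol{y}$; $\mathcal{G}$ is a Gröbner basis of $I$ for the block order $T_x>T_y$; $\mathcal{G}_x=\mathcal{G}\setminus k[\boldsymbol{y}]$. $\mathtt{LM}_{T_x}(g)$, $\mathtt{LC}_{T_x}(g)\in k[\boldsymbol{y}]$ are the $T_x$-leading monomial and its coefficient for $g$ viewed as a polynomial in $\boldsymbol{x}$ over $k[\boldsymbol{y}]$. Non-finite locus: $J_i=\{\mathtt{LC}_{x_i}(f)\mid f\in I\cap k[\boldsymbol{y},x_i]\}$ (leading coefficient in $x_i$ over $k[\boldsymbol{y}]$, with $\mathtt{LC}_{x_i}(0)=0$), an ideal of $k[\boldsymbol{y}]$ containing $J$, and $W=\bigcup_{i=1}^nV(J_i)\subseteq\operatorname{Spec}A$; it is the smallest closed subset over whose complement $\operatorname{Spec}B\to\operatorname{Spec}A$ is finite. The module $B'$: let $\mathcal{P}_i=\{g\in\mathcal{G}_x\mid\mathtt{LM}_{T_x}(g)=x_i^{d(g)}\text{ for some }d(g)>0\}$. If some $\mathcal{P}_i$ is empty, the finite locus is empty ($W=\operatorname{Spec}A$) and $F$ is not defined; $V(F)$ is then read as empty. Otherwise let $t_i=\max\{d(g)\mid g\in\mathcal{P}_i\}$, $\mathcal{M}=\{\prod_{i=1}^nx_i^{a_i}\mid 0\le a_i\le t_i-1\}=\{\mathfrak{m}_1,\ldots,\mathfrak{m}_r\}$,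 and let $B'\subseteq B$ be the $A$-submodule generated by the residue classes of the $\mathfrak{m}_j$. The matrix $N$: introduce new variables $\tau,u_1,\ldots,u_r$ and let $\mathcal{L}=I+\langle u_j-\tau\mathfrak{m}_j\mid j=1,\ldots,r\rangle\subseteq k[\boldsymbol{y},\boldsymbol{x},\tau,\boldsymbol{u}]$, which is homogeneous in $(\tau,\boldsymbol{u})$. Let $\mathcal{H}$ be a Gröbner basis of $\mathcal{L}$, consisting of polynomials homogeneous in $(\tau,\boldsymbol{u})$, for a block order $[\boldsymbol{x},\tau]>[\boldsymbol{u}]>[\boldsymbol{y}]$ whose order in $\boldsymbol{u}$ is degree-compatible, and let $\{h_1,\ldots,h_s\}=\{h\in\mathcal{H}\cap k[\boldsymbol{y},\boldsymbol{u}]\mid\deg_{\boldsymbol{u}}(h)=1\}$. Write $h_j=\sum_{i=1}^rn_{ij}(\boldsymbol{y})u_i$ and $N=(n_{ij})$, an $r\times s$ matrix; over $A$ it gives a presentation $A^s\xrightarrow{N}A^r\to B'\to0$. The flatness ideal: for $i=-1,0,\ldots,r$ put $F_i=J+\langle\mathtt{minors}(N,r-i)\rangle$, where $\mathtt{minors}(N,j)$ is the set of $j\times j$ minors of $N$ (nonexistent minors contribute nothing, so $F_{-1}=J$; the unique $0\times0$ minor is $1$). Then $F=\sum_{i=0}^r\bigl((J:F_{i-1})\cap F_i\bigr)\subseteq k[\boldsymbol{y}]$. *)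

(* Defs.v *)
From HB Require Import structures.
From mathcomp Require Import all_boot all_order all_algebra.
From mathcomp Require Import ring_quotient boolp mpoly ring.

Set Implicit Arguments.
Unset Strict Implicit.
Unset Printing Implicit Defensive.

Import GRing.Theory.
Local Open Scope ring_scope.
Local Open Scope quotient_scope.

(** The unit ideal is allowed, unlike in [ring_quotient], and the quotient and
    localized rings may be zero. *)

Section Ideals.
Variable R : comPzRingType.

Record ideal := Ideal {
  ideal_mem :> R -> Prop;
  ideal0 : ideal_mem 0;
  idealD : forall x y, ideal_mem x -> ideal_mem y -> ideal_mem (x + y);
  idealM : forall a x, ideal_mem x -> ideal_mem (a * x) }.

Definition ideal_gen (X : R -> Prop) (f : R) : Prop :=
  exists s : seq (R * R),
    (forall p, p \in s -> X p.2) /\ f = \sum_(p <- s) p.1 * p.2.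

Definition colon (I K : R -> Prop) (f : R) : Prop :=
  forall g, K g -> I (f * g).

(** [minors M j x]: [x] is a [j x j] minor of [M]. There is none when [j]
    exceeds a dimension of [M], and the only one for [j = 0] is [1]. *)
Definition minors p q (M : 'M[R]_(p, q)) (j : nat) (x : R) : Prop :=
  exists (f : 'I_j -> 'I_p) (g : 'I_j -> 'I_q),
    [/\ {homo f : a b / (a < b)%N}, {homo g : a b / (a < b)%N}
      & x = \det (mxsub f g M)].

End Ideals.

Definition preim_ideal (R S : comPzRingType) (f : {rmorphism R -> S})
  (I : ideal S) : ideal R.
Proof.
refine (@Ideal R (fun x => I (f x)) _ _ _).
- by rewrite rmorph0; apply: ideal0.
- by move=> x y Ix Iy; rewrite rmorphD; apply: idealD.
- by move=> a x Ix; rewrite rmorphM; apply: idealM.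
Defined.

Section Quotient.
Variables (R : comPzRingType) (I : ideal R).

Definition ideal_bool : R -> bool := fun x => `[< I x >].

Fact ideal_bool_zmod : zmod_closed ideal_bool.
Proof.
split; first by apply/asboolP/ideal0.
move=> x y /asboolP Ix /asboolP Iy; apply/asboolP/idealD => //.
by rewrite -mulN1r; apply: idealM.
Qed.
HB.instance Definition _ := GRing.isZmodClosed.Build R ideal_bool
  ideal_bool_zmod.

Definition quotr : Type := Quotient.quot (GRing.ZmodClosed.clone R ideal_bool _).
HB.instance Definition _ := GRing.Zmodule.on quotr.
HB.instance Definition _ := EqQuotient.on quotr.

Definition quot_pi (x : R) : quotr := \pi_quotr x.

Lemma quot_pi_eq x y : quot_pi x = quot_pi y <-> I (x - y).
Proof.
split=> [/eqP|h].
  by rewrite /quot_pi piE Quotient.equivE => /asboolP.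
by apply/eqP; rewrite /quot_pi piE Quotient.equivE; apply/asboolP.
Qed.

Lemma quot_piK (x : quotr) : quot_pi (repr x) = x.
Proof. exact: reprK. Qed.

Lemma quot_piD : {morph quot_pi : x y / x + y}.
Proof. by move=> x y; exact: Quotient.pi_add. Qed.

Definition quotr_one : quotr := quot_pi 1.
Definition quotr_mul (x y : quotr) : quotr := quot_pi (repr x * repr y).

Lemma quotr_mulE x y : quotr_mul (quot_pi x) (quot_pi y) = quot_pi (x * y).
Proof.
apply/quot_pi_eq.
have hx : I (repr (quot_pi x) - x) by apply/quot_pi_eq/quot_piK.
have hy : I (repr (quot_pi y) - y) by apply/quot_pi_eq/quot_piK.
set x' := repr _ in hx *; set y' := repr _ in hy *.
have -> : x' * y' - x * y = y' * (x' - x) + x * (y' - y) by ring.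
by apply: idealD; apply: idealM.
Qed.

Fact quotr_mulA : associative quotr_mul.
Proof.
move=> x y z; rewrite -[x]quot_piK -[y]quot_piK -[z]quot_piK.
by rewrite !quotr_mulE mulrA.
Qed.
Fact quotr_mulC : commutative quotr_mul.
Proof. by move=> x y; rewrite /quotr_mul mulrC. Qed.
Fact quotr_mul1 : left_id quotr_one quotr_mul.
Proof. by move=> x; rewrite -[x]quot_piK quotr_mulE mul1r. Qed.
Fact quotr_mulDl : left_distributive quotr_mul +%R.
Proof.
move=> x y z; rewrite -[x]quot_piK -[y]quot_piK -[z]quot_piK.
by rewrite -quot_piD !quotr_mulE mulrDl quot_piD.
Qed.
HB.instance Definition _ := GRing.Zmodule_isComPzRing.Build quotr
  quotr_mulA quotr_mulC quotr_mul1 quotr_mulDl.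

Fact quot_pi_zmod : zmod_morphism quot_pi.
Proof.
move=> x y; apply: (@addIr _ (quot_pi y)).
by rewrite -quot_piD !subrK.
Qed.
HB.instance Definition _ := GRing.isZmodMorphism.Build R quotr quot_pi
  quot_pi_zmod.
Fact quot_pi_monoid : monoid_morphism quot_pi.
Proof. by split=> // x y; rewrite -quotr_mulE. Qed.
HB.instance Definition _ := GRing.isMonoidMorphism.Build R quotr quot_pi
  quot_pi_monoid.

End Quotient.

Section QuotientMap.
Variables (R S : comPzRingType) (f : {rmorphism R -> S}) (I : ideal S).

Definition quot_map (x : quotr (preim_ideal f I)) : quotr I :=
  quot_pi I (f (repr x)).

Lemma quot_mapE x : quot_map (quot_pi (preim_ideal f I) x) = quot_pi I (f x).
Proof.
apply/quot_pi_eq; rewrite -rmorphB.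
by apply: (proj1 (quot_pi_eq (preim_ideal f I) _ _)); rewrite quot_piK.
Qed.

Fact quot_map_zmod : zmod_morphism quot_map.
Proof.
move=> x y; rewrite -[x]quot_piK -[y]quot_piK -rmorphB !quot_mapE.
by rewrite !rmorphB.
Qed.
HB.instance Definition _ := GRing.isZmodMorphism.Build
  (quotr (preim_ideal f I)) (quotr I) quot_map quot_map_zmod.
Fact quot_map_monoid : monoid_morphism quot_map.
Proof.
split; first by rewrite -(rmorph1 (quot_pi _)) quot_mapE !rmorph1.
move=> x y; rewrite -[x]quot_piK -[y]quot_piK -rmorphM !quot_mapE.
by rewrite !rmorphM.
Qed.
HB.instance Definition _ := GRing.isMonoidMorphism.Build
  (quotr (preim_ideal f I)) (quotr I) quot_map quot_map_monoid.

End QuotientMap.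
Arguments quot_map {R S} f I x.

(** The localization [R_a]: the pair [(x, n)] stands for [x / a ^+ n]. *)

Section Localization.
Variables (R : comPzRingType) (a : R).

Definition loc_rel (x y : R * nat) : bool :=
  `[< exists l, a ^+ l * (a ^+ y.2 * x.1 - a ^+ x.2 * y.1) = 0 >].

Fact loc_rel_equiv : equiv_class_of loc_rel.
Proof.
split=> [[x n]|[x n] [y p]|[y p] [x n] [z q]].
- by apply/asboolP; exists 0%N; rewrite subrr mulr0.
- by apply/asboolP/asboolP => -[l e]; exists l; apply/eqP;
    rewrite -[_ * _]opprK oppr_eq0 -mulrN opprB; apply/eqP.
- move=> /asboolP[l /= e] /asboolP[l' /= e']; apply/asboolP.
  exists (l + l' + p)%N => /=.
  have -> : a ^+ (l + l' + p) * (a ^+ q * x - a ^+ n * z) =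
    a ^+ l' * a ^+ q * (a ^+ l * (a ^+ p * x - a ^+ n * y)) +
    a ^+ l * a ^+ n * (a ^+ l' * (a ^+ q * y - a ^+ p * z)).
    by rewrite !exprD; ring.
  by rewrite e e' !mulr0 addr0.
Qed.
Canonical loc_equiv := EquivRelPack loc_rel_equiv.
Canonical loc_encModRel := defaultEncModRel loc_rel.

Definition loc : Type := {eq_quot loc_rel}.
HB.instance Definition _ : EqQuotient _ loc_rel loc := EqQuotient.on loc.
HB.instance Definition _ := Choice.on loc.

Definition frac (x : R) (n : nat) : loc := \pi_loc (x, n).

Lemma frac_eq x n y p :
  frac x n = frac y p <-> exists l, a ^+ l * (a ^+ p * x - a ^+ n * y) = 0.
Proof.
split=> [/eqP|h].
  by rewrite /frac piE => /asboolP.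
by apply/eqP; rewrite /frac piE; apply/asboolP.
Qed.

Lemma loc_ind (P : loc -> Prop) : (forall x n, P (frac x n)) -> forall z, P z.
Proof. by move=> h z; rewrite -[z]reprK; case: (repr z) => x n; apply: h. Qed.

Definition loc_add (z w : loc) : loc :=
  frac (a ^+ (repr w).2 * (repr z).1 + a ^+ (repr z).2 * (repr w).1)
       ((repr z).2 + (repr w).2).
Definition loc_mul (z w : loc) : loc :=
  frac ((repr z).1 * (repr w).1) ((repr z).2 + (repr w).2).
Definition loc_opp (z : loc) : loc := frac (- (repr z).1) (repr z).2.

Lemma frac_repr x n : exists l,
  a ^+ l * (a ^+ n * (repr (frac x n)).1 - a ^+ (repr (frac x n)).2 * x) = 0.
Proof.
by apply/frac_eq; rewrite /frac -surjective_pairing reprK.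
Qed.

Lemma loc_addE x n y p : loc_add (frac x n) (frac y p) =
  frac (a ^+ p * x + a ^+ n * y) (n + p).
Proof.
apply/frac_eq; have [l e] := frac_repr x n; have [l' e'] := frac_repr y p.
move: (repr _) (repr _) e e' => [y' p'] [x' n'] /= e e'; exists (l + l')%N.
rewrite !exprD; transitivity
  (a ^+ l' * a ^+ p * a ^+ p' * (a ^+ l * (a ^+ n * x' - a ^+ n' * x)) +
   a ^+ l * a ^+ n * a ^+ n' * (a ^+ l' * (a ^+ p * y' - a ^+ p' * y))).
  by ring.
by rewrite e e' !mulr0 addr0.
Qed.

Lemma loc_mulE x n y p : loc_mul (frac x n) (frac y p) = frac (x * y) (n + p).
Proof.
apply/frac_eq; have [l e] := frac_repr x n; have [l' e'] := frac_repr y p.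
move: (repr _) (repr _) e e' => [y' p'] [x' n'] /= e e'; exists (l + l')%N.
rewrite !exprD; transitivity
  (a ^+ l' * a ^+ p * y' * (a ^+ l * (a ^+ n * x' - a ^+ n' * x)) +
   a ^+ l * a ^+ n' * x * (a ^+ l' * (a ^+ p * y' - a ^+ p' * y))).
  by ring.
by rewrite e e' !mulr0 addr0.
Qed.

Lemma loc_oppE x n : loc_opp (frac x n) = frac (- x) n.
Proof.
apply/frac_eq; have [l e] := frac_repr x n; exists l.
by rewrite !mulrN -opprD mulrN e oppr0.
Qed.

Fact loc_addA : associative loc_add.
Proof.
elim/loc_ind=> x n; elim/loc_ind=> y p; elim/loc_ind=> z q.
by rewrite !loc_addE addnA; congr frac; rewrite !exprD; ring.
Qed.
Fact loc_addC : commutative loc_add.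
Proof.
elim/loc_ind=> x n; elim/loc_ind=> y p.
by rewrite !loc_addE addnC addrC.
Qed.
Fact loc_add0 : left_id (frac 0 0) loc_add.
Proof.
by elim/loc_ind=> x n; rewrite loc_addE mulr0 add0r expr0 mul1r.
Qed.
Fact loc_addN : left_inverse (frac 0 0) loc_opp loc_add.
Proof.
elim/loc_ind=> x n; rewrite loc_oppE loc_addE; apply/frac_eq; exists 0%N.
by rewrite mulrN addNr !mulr0 subrr mulr0.
Qed.
HB.instance Definition _ := GRing.isZmodule.Build loc
  loc_addA loc_addC loc_add0 loc_addN.

Fact loc_mulA : associative loc_mul.
Proof.
elim/loc_ind=> x n; elim/loc_ind=> y p; elim/loc_ind=> z q.
by rewrite !loc_mulE addnA mulrA.
Qed.
Fact loc_mulC : commutative loc_mul.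
Proof.
by elim/loc_ind=> x n; elim/loc_ind=> y p; rewrite !loc_mulE addnC mulrC.
Qed.
Fact loc_mul1 : left_id (frac 1 0) loc_mul.
Proof. by elim/loc_ind=> x n; rewrite loc_mulE mul1r. Qed.
Fact loc_mulDl : left_distributive loc_mul +%R.
Proof.
elim/loc_ind=> x n; elim/loc_ind=> y p; elim/loc_ind=> z q.
rewrite -[_ + _]/(loc_add _ _) -[RHS]/(loc_add _ _).
rewrite loc_addE !loc_mulE loc_addE; apply/frac_eq; exists 0%N.
by rewrite !exprD; ring.
Qed.
HB.instance Definition _ := GRing.Zmodule_isComPzRing.Build loc
  loc_mulA loc_mulC loc_mul1 loc_mulDl.

Lemma fracD x n y p : frac x n + frac y p =
  frac (a ^+ p * x + a ^+ n * y) (n + p).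
Proof. exact: loc_addE. Qed.
Lemma fracM x n y p : frac x n * frac y p = frac (x * y) (n + p).
Proof. exact: loc_mulE. Qed.
Lemma fracN x n : - frac x n = frac (- x) n.
Proof. exact: loc_oppE. Qed.

End Localization.

Section LocalizationMap.
Variables (R S : comPzRingType) (f : {rmorphism R -> S}) (a : R).

Definition loc_map (z : loc a) : loc (f a) :=
  frac (f a) (f (repr z).1) (repr z).2.

Lemma loc_mapE x n : loc_map (frac a x n) = frac (f a) (f x) n.
Proof.
apply/frac_eq; have [l e] := frac_repr a x n; exists l.
by rewrite -!rmorphXn -!rmorphM -rmorphB -rmorphM e rmorph0.
Qed.

Fact loc_map_zmod : zmod_morphism loc_map.
Proof.
elim/loc_ind=> x n; elim/loc_ind=> y p.
rewrite fracN fracD !loc_mapE fracN fracD.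
by rewrite rmorphD !rmorphM !rmorphXn rmorphN.
Qed.
HB.instance Definition _ := GRing.isZmodMorphism.Build (loc a) (loc (f a))
  loc_map loc_map_zmod.
Fact loc_map_monoid : monoid_morphism loc_map.
Proof.
split; first by rewrite -[1]/(frac a 1 0) loc_mapE rmorph1.
elim/loc_ind=> x n; elim/loc_ind=> y p.
by rewrite fracM !loc_mapE fracM rmorphM.
Qed.
HB.instance Definition _ := GRing.isMonoidMorphism.Build (loc a) (loc (f a))
  loc_map loc_map_monoid.

End LocalizationMap.
Arguments loc_map {R S} f a z.

(** [S] as an [R]-module through [f : R -> S]. *)
Definition restr (R S : comPzRingType) (f : {rmorphism R -> S}) : Type := S.

Section Restriction.
Variables (R S : comPzRingType) (f : {rmorphism R -> S}).
Local Notation restr := (restr f).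

HB.instance Definition _ := GRing.Zmodule.on restr.
Definition restr_scale (a : R) (x : restr) : restr := f a * (x : S).
Fact restr_scaleA a b x :
  restr_scale a (restr_scale b x) = restr_scale (a * b) x.
Proof. by rewrite /restr_scale rmorphM mulrA. Qed.
Fact restr_scale1 : left_id 1 restr_scale.
Proof. by move=> x; rewrite /restr_scale rmorph1 mul1r. Qed.
Fact restr_scaleDr : right_distributive restr_scale +%R.
Proof. by move=> a x y; apply: mulrDr. Qed.
Fact restr_scaleDl x : {morph restr_scale^~ x : a b / a + b}.
Proof. by move=> a b; rewrite /restr_scale rmorphD; apply: mulrDl. Qed.
HB.instance Definition _ := GRing.Zmodule_isLmodule.Build R restr
  restr_scaleA restr_scale1 restr_scaleDr restr_scaleDl.

End Restriction.

Definition module_finite (R : comPzRingType) (M : lmodType R) : Prop :=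
  exists (d : nat) (e : 'I_d -> M),
    forall x : M, exists c : 'I_d -> R, x = \sum_(i < d) c i *: e i.

Definition is_bilinear (R : comPzRingType) (M N P : lmodType R)
    (b : M -> N -> P) : Prop :=
  (forall y, linear (b^~ y)) /\ (forall x, linear (b x)).

(** A list [s] of pairs stands for the element [\sum_(p <- s) p.1 (x) p.2] of
    the tensor product of [M] and [N]. By its universal property, two such sums
    are equal iff no bilinear map tells them apart. *)
Definition tensor_eq (R : comPzRingType) (M N : lmodType R)
    (s t : seq (M * N)) : Prop :=
  forall (P : lmodType R) (b : M -> N -> P), is_bilinear b ->
    \sum_(p <- s) b p.1 p.2 = \sum_(p <- t) b p.1 p.2.

(** Tensoring with [N] preserves injectivity of linear maps. *)
Definition flat (R : comPzRingType) (N : lmodType R) : Prop :=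
  forall (M' M : lmodType R) (f : {linear M' -> M}), injective f ->
    forall s t : seq (M' * N),
      tensor_eq [seq (f p.1, p.2) | p <- s] [seq (f p.1, p.2) | p <- t] ->
      tensor_eq s t.

Definition is_derivation (R S : comPzRingType) (f : {rmorphism R -> S})
    (M : lmodType S) (D : S -> M) : Prop :=
  [/\ {morph D : x y / x + y},
      forall x y, D (x * y) = x *: D y + y *: D x
    & forall a, D (f a) = 0].

(** [(Omega, d)] is the module of Kähler differentials of [S] over [R]. *)
Definition is_kaehler (R S : comPzRingType) (f : {rmorphism R -> S})
    (Omega : lmodType S) (d : S -> Omega) : Prop :=
  is_derivation f d /\
  forall (M : lmodType S) (D : S -> M), is_derivation f D ->
    exists! h : Omega -> M, linear h /\ D =1 h \o d.

Definition unramified (R S : comPzRingType) (f : {rmorphism R -> S}) : Prop :=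
  exists (Omega : lmodType S) (d : S -> Omega),
    is_kaehler f d /\ forall w : Omega, w = 0.

(** Étale means flat, unramified and of finite presentation. The last property
    is not repeated: it follows from finiteness over a noetherian base, and
    only noetherian bases are considered here. *)
Definition finite_etale (R S : comPzRingType) (f : {rmorphism R -> S}) : Prop :=
  [/\ module_finite (restr f), flat (restr f) & unramified f].

Record spec (R : comPzRingType) := Spec {
  spec_ideal :> ideal R;
  spec_proper : ~ spec_ideal 1;
  spec_prime : forall x y, spec_ideal (x * y) -> spec_ideal x \/ spec_ideal y }.

Definition zero_locus (R : comPzRingType) (K : R -> Prop) (P : spec R) : Prop :=
  forall x, K x -> P x.

Definition spec_open (R : comPzRingType) (U : spec R -> Prop) : Prop :=
  exists K : R -> Prop, forall P, U P <-> ~ zero_locus K P.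

(** [Spec S -> Spec R] is finite étale over the open set [U]: the set [U] is
    covered by basic open sets [D(a)] with [R_a -> S_(f a)] finite étale. *)
Definition finite_etale_over (R S : comPzRingType) (f : {rmorphism R -> S})
    (U : spec R -> Prop) : Prop :=
  forall P, U P -> exists a : R,
    [/\ ~ P a, forall Q : spec R, ~ Q a -> U Q & finite_etale (loc_map f a)].

Definition is_largest_open (R : comPzRingType)
    (prop : (spec R -> Prop) -> Prop) (U : spec R -> Prop) : Prop :=
  [/\ spec_open U, prop U
    & forall U', spec_open U' -> prop U' -> forall P, U' P -> U P].

Definition monomial_order n (T : rel 'X_{1..n}) : Prop :=
  [/\ total T, antisymmetric T, transitive T,
      forall a b c : 'X_{1..n}, T a b -> T (a + c)%MM (b + c)%MM
    & well_founded (fun a b => (a != b) && T a b)].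

Definition degree_compatible n (T : rel 'X_{1..n}) : Prop :=
  forall a b : 'X_{1..n}, (mdeg a < mdeg b)%N -> T a b.

(** The exponents of the monomial [a] at the variables [f 0, f 1, ...]. *)
Definition mpart N q (f : 'I_q -> 'I_N) (a : 'X_{1..N}) : 'X_{1..q} :=
  [multinom a (f i) | i < q].

Definition part_order N q (f : 'I_q -> 'I_N) (T : rel 'X_{1..q}) :
    rel 'X_{1..N} :=
  fun a b => T (mpart f a) (mpart f b).

(** The block order comparing first by [T] on the variables [f 0, f 1, ...] and
    then by [T']. *)
Definition block_order N q (f : 'I_q -> 'I_N) (T : rel 'X_{1..q})
    (T' : rel 'X_{1..N}) : rel 'X_{1..N} :=
  fun a b => if mpart f a == mpart f b then T' a b else part_order f T a b.

(** The [T]-largest monomial of a list; [0%MM] is the least monomial. *)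
Definition max_mon n (T : rel 'X_{1..n}) (s : seq 'X_{1..n}) : 'X_{1..n} :=
  foldr (fun a b => if T a b then b else a) 0%MM s.

Section Polynomials.
Variable k : fieldType.

Definition lead_mon n (T : rel 'X_{1..n}) (p : {mpoly k[n]}) : 'X_{1..n} :=
  max_mon T (msupp p).

(** [G] lies in [I], and the leading monomials of [G] and of [I] generate the
    same ideal. *)
Definition groebner n (T : rel 'X_{1..n}) (I : {mpoly k[n]} -> Prop)
    (G : seq {mpoly k[n]}) : Prop :=
  (forall g, g \in G -> I g) /\
  forall p : {mpoly k[n]},
    ideal_gen (fun q : {mpoly k[n]} => exists g,
      [/\ g \in G, g != 0 & q = 'X_[lead_mon T g]]) p <->
    ideal_gen (fun q : {mpoly k[n]} => exists g,
      [/\ I g, g != 0 & q = 'X_[lead_mon T g]]) p.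

Definition rename q N (f : 'I_q -> 'I_N) : {mpoly k[q]} -> {mpoly k[N]} :=
  comp_mpoly [tuple 'X_(f i) | i < q].
HB.instance Definition _ q N (f : 'I_q -> 'I_N) :=
  GRing.RMorphism.copy (rename f) (comp_mpoly [tuple 'X_(f i) | i < q]).

(** Only variables satisfying [S] occur in [p]. *)
Definition in_vars N (S : pred 'I_N) (p : {mpoly k[N]}) : bool :=
  all (fun a : 'X_{1..N} => [forall i, (a i != 0%N) ==> S i]) (msupp p).

Definition homogeneous_in N q (f : 'I_q -> 'I_N) (p : {mpoly k[N]}) : Prop :=
  exists d, forall a, a \in msupp p -> mdeg (mpart f a) = d.

Definition deg_in N q (f : 'I_q -> 'I_N) (p : {mpoly k[N]}) : nat :=
  \max_(a <- msupp p) mdeg (mpart f a).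

(** [k[y_1..y_m, x_1..x_n]] is [{mpoly k[m + n]}], with the [y_i] first. *)

Section Setting.
Variables m n : nat.

Definition yvar : 'I_m -> 'I_(m + n) := @lshift m n.
Definition xvar : 'I_n -> 'I_(m + n) := @rshift m n.
Definition is_y : pred 'I_(m + n) := fun j => j \in codom yvar.

Definition yincl : {mpoly k[m]} -> {mpoly k[m + n]} := rename yvar.
HB.instance Definition _ := GRing.RMorphism.on yincl.

(** The coefficient in [k[y]] of the monomial [c] in [x]. *)
Definition xcoef (c : 'X_{1..n}) (p : {mpoly k[m + n]}) : {mpoly k[m]} :=
  \sum_(a <- msupp p | mpart xvar a == c) p@_a *: 'X_[mpart yvar a].

Definition lead_mon_x (Tx : rel 'X_{1..n}) (p : {mpoly k[m + n]}) :=
  max_mon Tx [seq mpart xvar a | a <- msupp p].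

Definition xy_order (Tx : rel 'X_{1..n}) (Ty : rel 'X_{1..m}) :
    rel 'X_{1..m + n} :=
  block_order xvar Tx (part_order yvar Ty).

(** Meant for [p] in [k[y, x_i]]; it is [0] for [p = 0]. *)
Definition lead_coef_at (i : 'I_n) (p : {mpoly k[m + n]}) : {mpoly k[m]} :=
  xcoef (U_(i) *+ \max_(a <- msupp p) a (xvar i))%MM p.

Section IdealI.
Variable I : ideal {mpoly k[m + n]}.

Definition elim_ideal : ideal {mpoly k[m]} := preim_ideal yincl I.
Definition ringA := quotr elim_ideal.
HB.instance Definition _ := GRing.ComPzRing.on ringA.
Definition ringB := quotr I.
HB.instance Definition _ := GRing.ComPzRing.on ringB.
Definition structure_map : ringA -> ringB := quot_map yincl I.
HB.instance Definition _ := GRing.RMorphism.on structure_map.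

(** The closed subset of [Spec A] defined by a subset of [k[y]]. *)
Definition VA (K : {mpoly k[m]} -> Prop) : spec ringA -> Prop :=
  zero_locus (fun z => exists2 f, K f & z = quot_pi elim_ideal f).

Definition nonfinite_ideal (i : 'I_n) (c : {mpoly k[m]}) : Prop :=
  exists f, [/\ I f, in_vars [pred j | is_y j || (j == xvar i)] f
              & c = lead_coef_at i f].

Definition nonfinite_locus (P : spec ringA) : Prop :=
  exists i, VA (nonfinite_ideal i) P.

Definition jacobian t (g : 'I_t -> {mpoly k[m + n]}) :
    'M[{mpoly k[m + n]}]_(n, t) :=
  \matrix_(i < n, j < t) (g j)^`M(xvar i).

Definition jac_ideal t (g : 'I_t -> {mpoly k[m + n]}) :
    {mpoly k[m + n]} -> Prop :=
  ideal_gen (fun f => minors (jacobian g) n f \/ I f).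

Definition jac_locus t (g : 'I_t -> {mpoly k[m + n]}) : spec ringA -> Prop :=
  VA (fun f => jac_ideal g (yincl f)).

(** [pure_powers Tx G i] is the set of the [g] in [G], outside [k[y]], whose
    leading monomial in [x] is a positive power of [x_i]. *)
Definition pure_powers (Tx : rel 'X_{1..n}) (G : seq {mpoly k[m + n]})
    (i : 'I_n) : seq {mpoly k[m + n]} :=
  [seq g <- G | [&& ~~ in_vars is_y g, (0 < lead_mon_x Tx g i)%N
                  & lead_mon_x Tx g == (U_(i) *+ lead_mon_x Tx g i)%MM]].

Definition has_pure_powers (Tx : rel 'X_{1..n}) (G : seq {mpoly k[m + n]}) :=
  forall i, pure_powers Tx G i != [::].

Definition max_power (Tx : rel 'X_{1..n}) (G : seq {mpoly k[m + n]})
    (i : 'I_n) : nat :=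
  \max_(g <- pure_powers Tx G i) lead_mon_x Tx g i.

(** The [ms j] enumerate the monomials generating [B']. *)
Definition enum_module_monomials (Tx : rel 'X_{1..n})
    (G : seq {mpoly k[m + n]}) r (ms : 'I_r -> 'X_{1..n}) : Prop :=
  injective ms /\
  forall a : 'X_{1..n},
    (exists j, a = ms j) <-> (forall i, (a i < max_power Tx G i)%N).

(** [k[y, x, tau, u_1..u_r]] is [{mpoly k[m + n + (1 + r)]}], with the variables
    in this order. *)
Section BigRing.
Variable r : nat.

Definition xyvar : 'I_(m + n) -> 'I_(m + n + (1 + r)) := @lshift (m + n) (1 + r).
Definition tauuvar : 'I_(1 + r) -> 'I_(m + n + (1 + r)) :=
  @rshift (m + n) (1 + r).
Definition tauvar : 'I_(m + n + (1 + r)) := tauuvar (lshift r ord0).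
Definition uvar (j : 'I_r) : 'I_(m + n + (1 + r)) := tauuvar (rshift 1 j).
Definition xtauvar (i : 'I_(n + 1)) : 'I_(m + n + (1 + r)) :=
  match split i with inl i => xyvar (xvar i) | inr _ => tauvar end.
Definition is_yu : pred 'I_(m + n + (1 + r)) :=
  fun j => (j \in codom (xyvar \o yvar)) || (j \in codom uvar).

Definition xtau_u_y_order (T1 : rel 'X_{1..n + 1}) (T2 : rel 'X_{1..r})
    (T3 : rel 'X_{1..m}) : rel 'X_{1..m + n + (1 + r)} :=
  block_order xtauvar T1 (block_order uvar T2 (part_order (xyvar \o yvar) T3)).

Definition module_ideal (ms : 'I_r -> 'X_{1..n}) :
    {mpoly k[m + n + (1 + r)]} -> Prop :=
  ideal_gen (fun f => (exists2 p, I p & f = rename xyvar p) \/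
    exists j, f = 'X_(uvar j) -
                  'X_tauvar * rename (xyvar \o xvar) 'X_[ms j]).

(** [N] is the matrix of the elements [h_1, ..., h_s] of [H] lying in [k[y, u]]
    and of degree [1] in [u]. *)
Definition is_relation_matrix (H : seq {mpoly k[m + n + (1 + r)]}) s
    (N : 'M[{mpoly k[m]}]_(r, s)) : Prop :=
  exists h : 'I_s -> {mpoly k[m + n + (1 + r)]},
    [/\ injective h,
        forall p, (exists j, p = h j) <->
                  [/\ p \in H, in_vars is_yu p & deg_in uvar p = 1%N]
      & forall j, h j = \sum_(i < r) rename (xyvar \o yvar) (N i j) *
                                     'X_(uvar i)].

Definition flat_data (Tx : rel 'X_{1..n}) (G : seq {mpoly k[m + n]})
    (ms : 'I_r -> 'X_{1..n}) (T1 : rel 'X_{1..n + 1}) (T2 : rel 'X_{1..r})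
    (T3 : rel 'X_{1..m}) (H : seq {mpoly k[m + n + (1 + r)]}) s
    (N : 'M[{mpoly k[m]}]_(r, s)) : Prop :=
  [/\ enum_module_monomials Tx G ms,
      [/\ monomial_order T1, monomial_order T2, monomial_order T3
        & degree_compatible T2],
      groebner (xtau_u_y_order T1 T2 T3) (module_ideal ms) H,
      forall p, p \in H -> homogeneous_in tauuvar p
    & is_relation_matrix H N].

(** [fitting_ideal N i] is the ideal F_(i-1) = J + <minors (N, r - (i - 1))>,
    for [i <= r + 1]; the shift avoids the index [-1]. *)
Definition fitting_ideal s (N : 'M[{mpoly k[m]}]_(r, s)) (i : nat) :
    {mpoly k[m]} -> Prop :=
  ideal_gen (fun f => elim_ideal f \/ minors N (r.+1 - i) f).

Definition flatness_ideal s (N : 'M[{mpoly k[m]}]_(r, s)) :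
    {mpoly k[m]} -> Prop :=
  ideal_gen (fun f => exists i, [/\ (i <= r)%N,
    colon elim_ideal (fitting_ideal N i) f & fitting_ideal N i.+1 f]).

(** V(F), read as empty when F is not defined. *)
Definition flatness_locus (Tx : rel 'X_{1..n}) (G : seq {mpoly k[m + n]}) s
    (N : 'M[{mpoly k[m]}]_(r, s)) (P : spec ringA) : Prop :=
  has_pure_powers Tx G /\ VA (flatness_ideal N) P.

End BigRing.
End IdealI.
End Setting.
End Polynomials.
Arguments structure_map {k m n} I x.

(* Main.v *)
Require Import Defs.
From HB Require Import structures.
From mathcomp Require Import all_boot all_order all_algebra.
From mathcomp Require Import perm ring_quotient boolp mpoly ring.

(** Fix a prime [P] of [A]; it is shown that [P] avoids the three loci if and only
    if [B_a] is finite étale over [A_a] for some [a] not in [P].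

    Finiteness. Reducing an element of [I] in [k[y, x_i]] by the Gröbner basis shows
    that its leading coefficient lies in the ideal generated by [J] and the leading
    coefficients of the pure powers of [x_i]. Inverting one of the latter for each
    [i] makes [B] generated by the monomials of [B']. Conversely, a finite [B_a] makes
    a power of [a] the leading coefficient of a characteristic polynomial that
    annihilates [x_i].

    Flatness. The columns of [N] generate the relations between these monomials. The
    cokernel of a matrix [N] is flat if and only if [N = N Y N] for some [Y]: from
    flatness applied to the image of the transpose of [N] one gets a retraction of
    the relations, and such a retraction provides a dual basis. Locally at [P], this
    is in turn equivalent to the vanishing of the Schur complement of a minor of [N]
    not in [P] of maximal order, hence of the minors of the next order.

    Ramification. The differentials are the cokernel of the transposed Jacobian
    matrix. A minor of order [n] annihilates them, and if they vanish, expanding the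
    determinant of the identity, written as a product with the Jacobian matrix, gives
    a power of [a] as a combination of minors. *)

Set Implicit Arguments.
Unset Strict Implicit.
Unset Printing Implicit Defensive.

Import GRing.Theory.
Local Open Scope ring_scope.
Local Open Scope quotient_scope.

(** * Ideals and primes *)

Section GeneratedIdeals.
Variables (R : comPzRingType) (X : R -> Prop).

Lemma ideal_gen0 : ideal_gen X 0.
Proof. by exists [::]; rewrite big_nil. Qed.

Lemma ideal_genD x y : ideal_gen X x -> ideal_gen X y -> ideal_gen X (x + y).
Proof.
move=> [s [Xs ->]] [s' [Xs' ->]]; exists (s ++ s'); rewrite big_cat; split=> // p.
by rewrite mem_cat => /orP[/Xs|/Xs'].
Qed.

Lemma ideal_genM a x : ideal_gen X x -> ideal_gen X (a * x).
Proof.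
move=> [s [Xs ->]]; exists [seq (a * p.1, p.2) | p <- s]; split.
  by move=> _ /mapP[p /Xs Xp ->].
by rewrite big_map mulr_sumr; apply: eq_bigr => p _; rewrite mulrA.
Qed.

Definition gen_ideal : ideal R := Ideal ideal_gen0 ideal_genD ideal_genM.

Lemma ideal_gen_incl x : X x -> ideal_gen X x.
Proof.
move=> Xx; exists [:: (1, x)]; rewrite big_seq1 mul1r; split=> // p.
by rewrite inE => /eqP ->.
Qed.

End GeneratedIdeals.

Section IdealTheory.
Variables (R : comPzRingType) (K : ideal R).

Lemma ideal_sum (T : Type) (s : seq T) (Q : pred T) (F : T -> R) :
  (forall i, Q i -> K (F i)) -> K (\sum_(i <- s | Q i) F i).
Proof.
move=> KF; elim/big_rec: _ => [|i x Qi Kx]; first exact: ideal0.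
by apply: idealD => //; apply: KF.
Qed.

Lemma idealMr a x : K x -> K (x * a).
Proof. by rewrite mulrC; apply: idealM. Qed.

Lemma idealN x : K x -> K (- x).
Proof. by rewrite -mulN1r; apply: idealM. Qed.

Lemma idealB x y : K x -> K y -> K (x - y).
Proof. by move=> Kx Ky; apply: idealD => //; apply: idealN. Qed.

Lemma ideal_gen_sub (X : R -> Prop) x :
  (forall z, X z -> K z) -> ideal_gen X x -> K x.
Proof.
move=> XK [s [Xs ->]]; rewrite big_seq; apply: ideal_sum => p /Xs/XK.
exact: idealM.
Qed.

Lemma quot_pi_eq0 x : quot_pi K x = 0 <-> K x.
Proof. by rewrite -(rmorph0 (quot_pi K)) quot_pi_eq subr0. Qed.

End IdealTheory.

(** As an [ideal], an annihilator reduces a vanishing claim on a generated ideal to the generators,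
    and its quotient ring turns equality up to annihilated elements into plain equality. *)
Definition annihilator (S R : comPzRingType) (f : {rmorphism S -> R})
  (M : lmodType R) (T : Type) (x : T -> M) : ideal S.
Proof.
refine (@Ideal S (fun p => forall i, f p *: x i = 0) _ _ _).
- by move=> i; rewrite rmorph0 scale0r.
- by move=> p q Kp Kq i; rewrite rmorphD scalerDl Kp Kq addr0.
- by move=> p q Kq i; rewrite rmorphM -scalerA Kq scaler0.
Defined.

Section Primes.
Variables (R : comPzRingType) (P : spec R).

Lemma spec_notM x y : ~ P x -> ~ P y -> ~ P (x * y).
Proof. by move=> nx ny /spec_prime[]. Qed.

Lemma spec_notX x l : ~ P x -> ~ P (x ^+ l).
Proof.
move=> nx; elim: l => [|l IH]; first by rewrite expr0; apply: spec_proper.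
by rewrite exprS; apply: spec_notM.
Qed.

Lemma spec_not_prod (T : Type) (s : seq T) (F : T -> R) :
  (forall i, ~ P (F i)) -> ~ P (\prod_(i <- s) F i).
Proof.
move=> nF; elim/big_rec: _ => [|i x _ nx]; first exact: spec_proper.
exact: spec_notM.
Qed.

End Primes.

(** * Determinants and Fitting ideals *)

Section Determinants.
Variable R : comPzRingType.

(** Cauchy-Binet before grouping the terms by image: each row of the product is expanded
    multilinearly. All maps [f] occur, the non-injective ones with determinant zero. *)
Lemma det_mulmx_expand n p (A : 'M[R]_(n, p)) (B : 'M[R]_(p, n)) :
  \det (A *m B) =
  \sum_(f : {ffun 'I_n -> 'I_p}) (\prod_i A i (f i)) * \det (rowsub f B).
Proof.
rewrite /(\det (_ *m _)).
under eq_bigr => s _.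
  under eq_bigr => i _ do rewrite mxE.
  rewrite bigA_distr_bigA mulr_sumr /=; over.
rewrite exchange_big; apply: eq_bigr => f _ /=.
rewrite mulr_sumr; apply: eq_bigr => s _.
rewrite big_split mulrCA /=; congr (_ * (_ * _)).
by apply: eq_bigr => i _; rewrite mxE.
Qed.

Lemma det_rowsub_eq0 n p (f : 'I_n -> 'I_p) (B : 'M[R]_(p, n)) :
  ~~ injectiveb f -> \det (rowsub f B) = 0.
Proof.
case/injectivePn=> i [j nij e]; apply: (determinant_alternate nij) => l.
by rewrite !mxE e.
Qed.

(** No map from [p.+1] indices to [p] is injective, so each term of the expansion has a repeated
    row. *)
Lemma det_mulmx_small p (A : 'M[R]_(p.+1, p)) (B : 'M[R]_(p, p.+1)) :
  \det (A *m B) = 0.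
Proof.
rewrite det_mulmx_expand big1 // => f _.
rewrite det_rowsub_eq0 ?mulr0 //; apply/negP => /injectiveP /leq_card.
by rewrite !card_ord ltnn.
Qed.

(** Needed because [minors] admits only increasing index maps. The permutation is the increasing
    enumeration of the image of [f], pulled back through [f]. *)
Lemma injective_sort p j (f : 'I_j -> 'I_p) : injective f ->
  exists s : 'S_j, {homo f \o s : a b / (a < b)%N}.
Proof.
move=> fI; pose A := [set f i | i : 'I_j].
have cA : #|A| = j by rewrite card_imset // card_ord.
have sA : sorted ltn [seq val i | i <- enum A].
  rewrite /(enum _); set q := filter _ _.
  have sq : subseq [seq val i | i <- q] [seq val i | i <- enum 'I_p].
    by apply: map_subseq; rewrite /q enumT filter_subseq.
  apply: (subseq_sorted ltn_trans sq).
  by rewrite val_enum_ord iota_ltn_sorted.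
pose h (i : 'I_j) : 'I_p := enum_val (cast_ord (esym cA) i).
have hA i : exists l, h i == f l.
  have /imsetP[l _ ->] : h i \in A by apply: enum_valP.
  by exists l.
pose t i := xchoose (hA i).
have ht i : h i = f (t i) by apply/eqP/(xchooseP (hA i)).
have hlt : {homo h : a b / (a < b)%N}.
  move=> a b lt_ab; have x0 : 'I_p := h a.
  rewrite /h !(enum_val_nth x0) /=.
  have sz : size (enum A) = j by rewrite -cardE.
  have /(sorted_ltn_nth ltn_trans 0%N sA) := lt_ab.
  by rewrite !inE !size_map sz !ltn_ord !(nth_map x0) ?sz ?ltn_ord //; apply.
have tI : injective t.
  move=> a b e; apply/eqP; case: (ltngtP a b) => [||/val_inj ->//] /hlt;
    by rewrite !ht e ltnn.
exists (perm tI) => a b /hlt; by rewrite !ht /= !permE.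
Qed.

Lemma det_rowsub_perm p q j (f : 'I_j -> 'I_p) (g : 'I_j -> 'I_q)
    (M : 'M[R]_(p, q)) (s : 'S_j) :
  \det (mxsub f g M) = (-1) ^+ s * \det (mxsub (f \o s) g M).
Proof.
have -> : mxsub (f \o s) g M = row_perm s (mxsub f g M).
  by apply/matrixP => a b; rewrite !mxE.
by rewrite row_permE det_mulmx det_perm mulrA -signr_addb addbb mul1r.
Qed.

(** A repeated index gives determinant zero; otherwise sorting the rows and the columns costs only a
    sign. *)
Lemma det_mxsub_minors p q j (f : 'I_j -> 'I_p) (g : 'I_j -> 'I_q)
    (M : 'M[R]_(p, q)) : ideal_gen (minors M j) (\det (mxsub f g M)).
Proof.
have [fI|fN] := boolP (injectiveb f); last first.
  rewrite (_ : mxsub f g M = rowsub f (colsub g M)); last first.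
    by apply/matrixP => a b; rewrite !mxE.
  by rewrite det_rowsub_eq0 //; apply: ideal_gen0.
have [gI|gN] := boolP (injectiveb g); last first.
  rewrite -det_tr (_ : (mxsub f g M)^T = rowsub g (colsub f M^T)); last first.
    by apply/matrixP => a b; rewrite !mxE.
  by rewrite det_rowsub_eq0 //; apply: ideal_gen0.
have [s fs] := injective_sort (injectiveP _ fI).
have [s' gs'] := injective_sort (injectiveP _ gI).
rewrite (det_rowsub_perm _ _ _ s); apply: ideal_genM.
rewrite -det_tr trmx_mxsub (det_rowsub_perm _ _ _ s'); apply: ideal_genM.
apply: ideal_gen_incl; exists (f \o s), (g \o s'); split=> //.
by rewrite -det_tr trmx_mxsub trmxK.
Qed.

(** For [S = mxsub f g M], this is [\det S] times the classical Schur complement, with the adjugate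
    in place of the inverse so that nothing is divided. It keeps the full size of [M] and vanishes
    on the rows [f] and the columns [g]. *)
Definition schur p q j (f : 'I_j -> 'I_p) (g : 'I_j -> 'I_q)
    (M : 'M[R]_(p, q)) : 'M[R]_(p, q) :=
  \det (mxsub f g M) *: M -
  colsub g M *m (\adj (mxsub f g M) *m rowsub f M).

(** Up to a power of [\det (mxsub f g M)], the entries of the Schur complement are
    bordered minors. *)
Lemma schur_minors p q j (f : 'I_j -> 'I_p) (g : 'I_j -> 'I_q)
    (M : 'M[R]_(p, q)) a b :
  ideal_gen (minors M j.+1) (\det (mxsub f g M) ^+ j * schur f g M a b).
Proof.
set D := \det _; pose S := mxsub f g M.
(* The submatrix is bordered by row [a] and column [b] of [M]. *)
pose f' (i : 'I_(j + 1)) := if split i is inl i' then f i' else a.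
pose g' (i : 'I_(j + 1)) := if split i is inl i' then g i' else b.
pose B := \col_i M (f i) b; pose C := \row_i M a (g i).
have fE : mxsub f' g' M = block_mx S B C (M a b)%:M.
  rewrite -[LHS]submxK; congr block_mx; apply/matrixP => u v;
    rewrite !mxE /f' /g' ?(unsplitK (inl _)) ?(unsplitK (inr _)) //.
  by rewrite !ord1 eqxx mulr1n.
(* The triangular factor clears the upper right block. Comparing determinants shows that [D ^+ j]
   times the Schur entry is a multiple of the bordered minor. *)
have mulE : mxsub f' g' M *m block_mx (\adj S) (- (\adj S *m B)) 0 D%:M =
    block_mx D%:M 0 (C *m \adj S) (schur f g M a b)%:M.
  rewrite fE mulmx_block; congr block_mx.
  - by rewrite mul_mx_adj mulmx0 addr0.
  - by rewrite mulmxN mulmxA mul_mx_adj mul_scalar_mx mul_mx_scalar addNr.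
  - by rewrite mulmx0 addr0.
  - apply/matrixP => u v; rewrite !ord1 mulmxN -scalar_mxM /schur !mxE !eqxx.
    rewrite !mulr1n addrC [M a b * _]mulrC; congr (_ - _).
    apply: eq_bigr => i _; rewrite !mxE; congr (_ * _).
    by apply: eq_bigr => l _; rewrite !mxE.
have := congr1 determinant mulE.
rewrite det_mulmx det_ublock det_lblock !det_scalar expr1 => <-.
rewrite mulrC; apply: ideal_genM.
by case: _ / (addn1 j) (det_mxsub_minors f' g' M).
Qed.

End Determinants.

(** The left factor that turns [M] into its Schur complement. It differs from the scalar [D] by a
    matrix [M *m X], hence acts as [D] on the cokernel of [M]. Where [D] is invertible and the Schur
    complement vanishes, it splits the presentation. *)
Definition schur_proj (R : comPzRingType) p q j (f : 'I_j -> 'I_p)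
    (g : 'I_j -> 'I_q) (M : 'M[R]_(p, q)) : 'M[R]_p :=
  (\det (mxsub f g M))%:M -
  colsub g M *m (\adj (mxsub f g M) *m rowsub f 1%:M).

Lemma schur_projE (R : comPzRingType) p q j (f : 'I_j -> 'I_p)
    (g : 'I_j -> 'I_q) (M : 'M[R]_(p, q)) :
  schur_proj f g M *m M = schur f g M.
Proof.
rewrite mulmxBl mul_scalar_mx -!mulmxA; congr (_ - _ *m (_ *m _)).
by rewrite mul_rowsub_mx mul1mx.
Qed.

Lemma schur_proj_compl (R : comPzRingType) p q j (f : 'I_j -> 'I_p)
    (g : 'I_j -> 'I_q) (M : 'M[R]_(p, q)) :
  exists X, (\det (mxsub f g M))%:M - schur_proj f g M = M *m X.
Proof.
exists (colsub g 1%:M *m (\adj (mxsub f g M) *m rowsub f 1%:M)).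
by rewrite subKr [RHS]mulmxA mulmx_colsub mulmx1.
Qed.

(** Write [Z = E N = N F] for the Schur complement. Then [Z Y Z = E (N Y N) F = b Z F], and
    [Z F = D Z] because the columns [g] of [Z] are zero. *)
Lemma schur_regular (R : comPzRingType) p q j (f : 'I_j -> 'I_p)
    (g : 'I_j -> 'I_q) (N : 'M[R]_(p, q)) b Y :
  b *: N = N *m Y *m N ->
  (b * \det (mxsub f g N)) *: schur f g N = schur f g N *m Y *m schur f g N.
Proof.
set D := \det _; set Z := schur f g N => bN.
pose F := D%:M - colsub g 1%:M *m (\adj (mxsub f g N) *m rowsub f N).
have ZE : Z = N *m F.
  rewrite mulmxBr mul_mx_scalar; congr (_ - _).
  by rewrite mulmxA mulmx_colsub mulmx1.
have Zg : Z *m colsub g 1%:M = 0.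
  rewrite mulmx_colsub mulmx1 /Z /schur linearB linearZ /= -!mulmx_colsub.
  by rewrite -mxsubcr mul_adj_mx mul_mx_scalar subrr.
have ZF : Z *m F = D *: Z.
  by rewrite mulmxBr mul_mx_scalar mulmxA Zg mul0mx subr0.
rewrite -scalerA -ZF [in LHS]/Z -schur_projE scalemxAl scalemxAr.
by rewrite bN !mulmxA schur_projE -/Z -[_ *m N *m F]mulmxA -ZE.
Qed.

Lemma minors0 (R : comPzRingType) p q (M : 'M[R]_(p, q)) : minors M 0 1.
Proof.
have z T : 'I_0 -> T by case.
by exists (z _), (z _); split=> [[]|[]|]; rewrite ?det_mx00.
Qed.

Lemma homo_ltn_leq j p (f : 'I_j -> 'I_p) :
  {homo f : a b / (a < b)%N} -> (j <= p)%N.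
Proof.
move=> fh; have fI : injective f.
  by move=> a b e; case: (ltngtP a b) => [||/val_inj//] /fh; rewrite e ltnn.
by have := leq_card f fI; rewrite !card_ord.
Qed.

(** At a minor [D] of maximal order not in [P], the Schur complement [Z] has its
    entries in [P] and satisfies [(b D - Z Y) Z = 0], where the determinant of
    [b D - Z Y] is not in [P]. Hence [Z] vanishes near [P]. *)
Lemma regular_fitting (R : comPzRingType) (P : spec R) r s (N : 'M[R]_(r, s))
    b Y : ~ P b -> b *: N = N *m Y *m N ->
  exists i f, [/\ (i <= r)%N, ~ P f, ideal_gen (minors N (r - i)) f
    & forall x, minors N (r.+1 - i) x -> f * x = 0].
Proof.
move=> nPb bN.
pose Q j := `[< exists2 x, minors N j x & ~ P x >].
have Q0 : exists j, Q j.
  by exists 0%N; apply/asboolP; exists 1; [apply: minors0 | apply: spec_proper].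
have Qle j : Q j -> (j <= r)%N.
  by move=> /asboolP[x [f [g [fh _ _]]] _]; apply: homo_ltn_leq fh.
case: (ex_maxnP Q0 Qle) => j Qj jmax; have jr := Qle _ Qj.
move: Qj => /asboolP[D [f [g [fh gh DE]]] nPD].
have Pminors x : ideal_gen (minors N j.+1) x -> P x.
  apply: ideal_gen_sub => z mz; apply: contrapT => nPz.
  have /jmax : Q j.+1 by apply/asboolP; exists z.
  by rewrite ltnn.
set Z := schur f g N.
have PZ u v : P (Z u v).
  have /Pminors := schur_minors f g N u v.
  by rewrite -DE => /spec_prime[/(spec_notX nPD)|].
pose T := (b * D)%:M - Z *m Y.
have TZ : T *m Z = 0.
  by rewrite mulmxBl mul_scalar_mx DE (schur_regular _ _ bN) subrr.
pose d := \det T.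
have dZ u v : d * Z u v = 0.
  have := congr1 (fun M : 'M_(_, _) => M u v) (congr1 (mulmx (\adj T)) TZ).
  by rewrite mulmxA mul_adj_mx mul_scalar_mx mulmx0 !mxE.
(* Modulo [P] the entries of [Z] vanish, so [T] becomes scalar and [d] becomes the [r]-th power of
   [b * D]. *)
have nPd : ~ P d.
  move=> Pd; apply: (@spec_notX _ P (b * D) r); first exact: spec_notM.
  apply/(quot_pi_eq0 P); rewrite rmorphXn -det_scalar -map_scalar_mx.
  have <- : map_mx (quot_pi P) T = map_mx (quot_pi P) (b * D)%:M.
    rewrite map_mxB; apply/subr0_eq; rewrite addrAC subrr add0r.
    apply/eqP; rewrite oppr_eq0; apply/eqP/matrixP => u v.
    rewrite !mxE; apply/(quot_pi_eq0 P); apply: ideal_sum => i _.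
    exact: idealMr.
  by rewrite det_map_mx; apply/(quot_pi_eq0 P).
(* With [i = r - j] the orders [r - i] and [r.+1 - i] are [j] and [j.+1]. The power of [D] allows a
   minor of order [j.+1] to be taken in [D *: N]. *)
exists (r - j)%N, (d * D ^+ j.+1); split.
- exact: leq_subr.
- by apply: spec_notM => //; apply: spec_notX.
- rewrite subKn //; rewrite exprSr mulrA; apply: ideal_genM.
  by apply: ideal_gen_incl; exists f, g.
- rewrite subSn ?leq_subr // subKn // => x [f' [g' [_ _ ->]]].
  pose K := annihilator (idfun : {rmorphism R -> R}) (fun _ : unit => d : R^o).
  have KE y : K y <-> d * y = 0.
    by rewrite mulrC; split=> [/(_ tt)|h []].
  rewrite -mulrA -detZ; apply/KE/(quot_pi_eq0 K); rewrite -det_map_mx.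
  (* Modulo the annihilator of [d] the Schur complement is zero, so [D *: N] factors through [j]
     columns and its minors of order [j.+1] vanish. *)
  suff -> : map_mx (quot_pi K) (D *: mxsub f' g' N) =
      map_mx (quot_pi K) (rowsub f' (colsub g N) *m
        colsub g' (\adj (mxsub f g N) *m rowsub f N)).
    by rewrite map_mxM; apply: det_mulmx_small.
  apply/matrixP => u v; rewrite !mxE; apply/(quot_pi_eq K)/KE.
  rewrite -[RHS](dZ (f' u) (g' v)) !mxE -DE; congr (_ * (_ - _)).
  by apply: eq_bigr => i _; rewrite !mxE.
Qed.

(** Converse direction to [regular_fitting]: if [c] kills the minors of order [j.+1], then by
    [schur_minors] [c * D ^+ j] kills the Schur complement, which is [E *m N]. *)
Lemma fitting_schur (R : comPzRingType) r s (N : 'M[R]_(r, s)) j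
    (f : 'I_j -> 'I_r) (g : 'I_j -> 'I_s) c :
    (forall x, minors N j.+1 x -> c * x = 0) ->
  exists E X, (c * \det (mxsub f g N) ^+ j) *: (E *m N) = 0 /\
    (\det (mxsub f g N))%:M - E = N *m X.
Proof.
move=> cN; have [X XE] := schur_proj_compl f g N.
exists (schur_proj f g N), X; split=> //; rewrite schur_projE.
apply/matrixP => u v; rewrite [in RHS]mxE mxE -mulrA.
have [l [ml ->]] := schur_minors f g N u v.
rewrite mulr_sumr big_seq big1 // => p pl.
by rewrite mulrCA cN ?mulr0 //; apply: ml.
Qed.

(** * Quotient modules and flatness *)

Section QuotientModule.
Variables (R : comPzRingType) (V : lmodType R).

(** Quotient modules serve as test objects for universal properties: targets of the bilinear maps in
    [tensor_eq], and of derivations. *)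
Record submodule := Submodule {
  submod_mem :> V -> Prop;
  submod0 : submod_mem 0;
  submodD : forall x y, submod_mem x -> submod_mem y -> submod_mem (x + y);
  submodZ : forall a x, submod_mem x -> submod_mem (a *: x) }.

Variable K : submodule.

Definition submod_bool : V -> bool := fun x => `[< K x >].

Fact submod_bool_zmod : zmod_closed submod_bool.
Proof.
split; first by apply/asboolP/submod0.
move=> x y /asboolP Kx /asboolP Ky; apply/asboolP/submodD => //.
by rewrite -scaleN1r; apply: submodZ.
Qed.
HB.instance Definition _ := GRing.isZmodClosed.Build V submod_bool
  submod_bool_zmod.

Definition quotm : Type :=
  Quotient.quot (GRing.ZmodClosed.clone V submod_bool _).
HB.instance Definition _ := GRing.Zmodule.on quotm.
HB.instance Definition _ := EqQuotient.on quotm.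

Definition quotm_pi (x : V) : quotm := \pi_quotm x.

Lemma quotm_pi_eq x y : quotm_pi x = quotm_pi y <-> K (x - y).
Proof.
split=> [/eqP|h].
  by rewrite /quotm_pi piE Quotient.equivE => /asboolP.
by apply/eqP; rewrite /quotm_pi piE Quotient.equivE; apply/asboolP.
Qed.

Lemma quotm_piK (x : quotm) : quotm_pi (repr x) = x.
Proof. exact: reprK. Qed.

Lemma quotm_repr x : K (repr (quotm_pi x) - x).
Proof. by apply/quotm_pi_eq/quotm_piK. Qed.

Lemma quotm_piD : {morph quotm_pi : x y / x + y}.
Proof. by move=> x y; exact: Quotient.pi_add. Qed.

Definition quotm_scale (a : R) (x : quotm) : quotm := quotm_pi (a *: repr x).

Lemma quotm_scaleE a x : quotm_scale a (quotm_pi x) = quotm_pi (a *: x).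
Proof.
by apply/quotm_pi_eq; rewrite -scalerBr; apply: submodZ; apply: quotm_repr.
Qed.

Fact quotm_scaleA a b x :
  quotm_scale a (quotm_scale b x) = quotm_scale (a * b) x.
Proof. by rewrite -[x]quotm_piK !quotm_scaleE scalerA. Qed.
Fact quotm_scale1 : left_id 1 quotm_scale.
Proof. by move=> x; rewrite -[x]quotm_piK quotm_scaleE scale1r. Qed.
Fact quotm_scaleDr : right_distributive quotm_scale +%R.
Proof.
move=> a x y; rewrite -[x]quotm_piK -[y]quotm_piK.
by rewrite -quotm_piD !quotm_scaleE scalerDr quotm_piD.
Qed.
Fact quotm_scaleDl x : {morph quotm_scale^~ x : a b / a + b}.
Proof.
by move=> a b; rewrite -[x]quotm_piK !quotm_scaleE scalerDl quotm_piD.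
Qed.
HB.instance Definition _ := GRing.Zmodule_isLmodule.Build R quotm
  quotm_scaleA quotm_scale1 quotm_scaleDr quotm_scaleDl.

Fact quotm_pi_linear : linear quotm_pi.
Proof. by move=> a x y; rewrite quotm_piD -quotm_scaleE. Qed.
HB.instance Definition _ := GRing.isLinear.Build R V quotm _ quotm_pi
  quotm_pi_linear.

Lemma quotm_piZ a x : quotm_pi (a *: x) = a *: quotm_pi x.
Proof. by rewrite -quotm_scaleE. Qed.

Lemma quotm_pi_eq0 x : quotm_pi x = 0 <-> K x.
Proof. by rewrite -(linear0 quotm_pi) quotm_pi_eq subr0. Qed.

End QuotientModule.

Section KernelLift.
Variables (R : comPzRingType) (V W : lmodType R) (f : {linear V -> W}).

Definition ker_submod : submodule V.
Proof.
refine (@Submodule R V (fun x => f x = 0) (linear0 f) _ _).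
- by move=> x y fx fy; rewrite linearD fx fy addr0.
- by move=> a x fx; rewrite linearZ_LR fx scaler0.
Defined.

(** [flat] speaks of injective maps only; a general linear map becomes injective on the quotient by
    its kernel. *)
Definition ker_lift (x : quotm ker_submod) : W := f (repr x).

Lemma ker_liftE x : ker_lift (quotm_pi ker_submod x) = f x.
Proof. by apply/subr0_eq; rewrite -linearB; apply: (quotm_repr ker_submod). Qed.

Fact ker_lift_linear : linear ker_lift.
Proof.
move=> a x y; rewrite -[x]quotm_piK -[y]quotm_piK -linearP !ker_liftE.
exact: linearP.
Qed.
HB.instance Definition _ := GRing.isLinear.Build R _ W _ ker_lift
  ker_lift_linear.

Lemma ker_lift_inj : injective ker_lift.
Proof.
move=> x y; rewrite -[x]quotm_piK -[y]quotm_piK !ker_liftE => e.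
by apply/quotm_pi_eq; rewrite /= linearB e subrr.
Qed.

End KernelLift.

Section Bilinear.
Variables (R : comPzRingType) (M N P : lmodType R) (b : M -> N -> P).
Hypothesis bb : is_bilinear b.

Lemma bilin_suml (T : Type) (s : seq T) (c : T -> R) (F : T -> M) y :
  b (\sum_(i <- s) c i *: F i) y = \sum_(i <- s) c i *: b (F i) y.
Proof.
have bl := bb.1 y; elim: s => [|i s IH]; last by rewrite !big_cons bl IH.
by rewrite !big_nil -[0 in LHS](subrr 0) -[- 0]scaleN1r addrC bl scaleN1r addNr.
Qed.

Lemma bilin_sumr (T : Type) (s : seq T) (c : T -> R) (F : T -> N) x :
  b x (\sum_(i <- s) c i *: F i) = \sum_(i <- s) c i *: b x (F i).
Proof.
have bl := bb.2 x; elim: s => [|i s IH]; last by rewrite !big_cons bl IH.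
by rewrite !big_nil -[0 in LHS](subrr 0) -[- 0]scaleN1r addrC bl scaleN1r addNr.
Qed.

Lemma bilin0r x : b x 0 = 0.
Proof.
have := bilin_sumr (Nil unit) (fun=> 0) (fun=> 0) x.
by rewrite !big_nil.
Qed.

End Bilinear.

(** Flatness tests the injection of the quotient of [R ^ r] by the left kernel of
    [N] into [R ^ s] against the element [\sum_j e_j (x) e j]. *)
Lemma flat_relations (R : comPzRingType) (V : lmodType R) r s (N : 'M[R]_(r, s))
    (e : 'I_r -> V) :
  flat V -> (forall q, \sum_j N j q *: e j = 0) ->
  exists l : seq ('rV[R]_r * V), (forall p, p \in l -> p.1 *m N = 0) /\
    forall j, e j = \sum_(p <- l) p.1 0 j *: p.2.
Proof.
move=> flatV eN.
pose f : {linear 'rV[R]_r -> 'rV[R]_s} := mulmxr N.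
(* [S] is the image in [V ^ r] of the left kernel of [N] tensored with [V]. The map [b] below, into
   the quotient by [S], does not depend on representatives, since changing one moves the value by an
   element of [S]. *)
pose S (u : {ffun 'I_r -> V}) := exists l : seq ('rV[R]_r * V),
  (forall p, p \in l -> p.1 *m N = 0) /\
  forall j, u j = \sum_(p <- l) p.1 0 j *: p.2.
have S0 : S 0 by exists [::]; split=> // j; rewrite big_nil ffunE.
have SD u v : S u -> S v -> S (u + v).
  move=> [l [lN lE]] [l' [lN' lE']]; exists (l ++ l'); split=> [p|j].
    by rewrite mem_cat => /orP[/lN|/lN'].
  by rewrite ffunE big_cat lE lE'.
have SZ a u : S u -> S (a *: u).
  move=> [l [lN lE]]; exists [seq (a *: p.1, p.2) | p <- l]; split=> [p|j].
    by move=> /mapP[q /lN qN ->]; rewrite -scalemxAl qN scaler0.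
  rewrite ffunE lE scaler_sumr big_map; apply: eq_bigr => p _.
  by rewrite mxE scalerA.
pose K := Submodule S0 SD SZ.
pose M' := quotm (ker_submod f).
pose g (u : 'rV[R]_r) (v : V) : {ffun 'I_r -> V} := [ffun j => u 0 j *: v].
pose b (x : M') (v : V) : quotm K := quotm_pi K (g (repr x) v).
have bE u v : b (quotm_pi _ u) v = quotm_pi K (g u v).
  apply/quotm_pi_eq; exists [:: (repr (quotm_pi (ker_submod f) u) - u, v)].
  split=> [p|j]; last by rewrite !ffunE big_seq1 !mxE scalerBl.
  by rewrite inE => /eqP -> /=; apply: (quotm_repr (ker_submod f)).
have bb : is_bilinear b.
  split=> [y a x x'|x a y y'].
    rewrite -[x]quotm_piK -[x']quotm_piK -linearP !bE -linearP.
    congr quotm_pi; apply/ffunP => j; rewrite !ffunE !mxE.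
    by rewrite scalerDl scalerA.
  rewrite /b -linearP; congr quotm_pi; apply/ffunP => j; rewrite !ffunE.
  by rewrite scalerDr !scalerA mulrC.
(* This tensor dies in [R ^ s] tensored with [V], because the columns of [N] are relations between
   the [e j]. By flatness it is zero, hence so is its image under [b], the class of the family
   [e]. *)
pose t := [seq (quotm_pi (ker_submod f) (delta_mx 0 j), e j) | j <- enum 'I_r].
have /(_ (quotm K) b bb) : tensor_eq t [::].
  apply: (flatV _ _ (@ker_lift _ _ _ f) (@ker_lift_inj _ _ _ f)).
  move=> P c cb; rewrite big_nil !big_map /=.
  under eq_bigr => j _.
    rewrite [_ *m N](ker_liftE f (delta_mx 0 j)) /=.
    rewrite -rowE (row_sum_delta (row j N)) bilin_suml //; over.
  rewrite exchange_big big1 //= => q _; rewrite -enumT big_enum /=.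
  under eq_bigr do rewrite mxE.
  by rewrite -bilin_sumr // eN bilin0r.
rewrite big_nil big_map big_enum /=.
under eq_bigr do rewrite bE.
rewrite -linear_sum => /quotm_pi_eq0[l [lN lE]]; exists l; split=> // j.
rewrite -lE sum_ffunE (bigD1 j) //= big1 => [|i nij].
  by rewrite ffunE !mxE !eqxx scale1r addr0.
by rewrite ffunE !mxE eq_sym (negbTE nij) andbF scale0r.
Qed.

(** A dual basis rewrites any tensor as a sum over [j] of a coefficient tensored with [e j]. These
    coefficients are read off by the bilinear maps [phi v j *: x], so they can be compared after
    applying the injective [f]. *)
Lemma flat_dual_basis (R : comPzRingType) (V : lmodType R) r (e : 'I_r -> V)
    (phi : V -> 'I_r -> R) :
    (forall j a x y, phi (a *: x + y) j = a * phi x j + phi y j) ->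
    (forall x, x = \sum_j phi x j *: e j) -> flat V.
Proof.
move=> phiP phiE M' M f fI s t st P b bb.
have E (u : seq (M' * V)) : \sum_(p <- u) b p.1 p.2 =
    \sum_j b (\sum_(p <- u) phi p.2 j *: p.1) (e j).
  under [RHS]eq_bigr do rewrite bilin_suml //.
  rewrite exchange_big; apply: eq_bigr => p _.
  by rewrite {1}(phiE p.2) bilin_sumr.
rewrite !E; apply: eq_bigr => j _; congr b; apply: fI; rewrite !linear_sum.
pose c (x : M) (v : V) := phi v j *: x.
have cb : is_bilinear c.
  split=> [y a x x'|x a y y'].
    by rewrite /c scalerDr !scalerA mulrC.
  by rewrite /c phiP scalerDl scalerA.
have := st _ c cb; rewrite !big_map => cE.
under eq_bigr do rewrite linearZ; rewrite [LHS]cE.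
by apply: eq_bigr => p _; rewrite linearZ.
Qed.

(** * Localization *)

Local Notation frac := Defs.frac.

Section LocalizationTheory.
Variables (R : comPzRingType) (a : R).

Definition to_loc (x : R) : loc a := frac a x 0.

Fact to_loc_zmod : zmod_morphism to_loc.
Proof.
by move=> x y; rewrite /to_loc fracN fracD !expr0 !mul1r.
Qed.
HB.instance Definition _ := GRing.isZmodMorphism.Build R (loc a) to_loc to_loc_zmod.
Fact to_loc_monoid : monoid_morphism to_loc.
Proof. by split=> // x y; rewrite /to_loc fracM. Qed.
HB.instance Definition _ := GRing.isMonoidMorphism.Build R (loc a) to_loc
  to_loc_monoid.

Lemma to_loc_eq0 x : to_loc x = 0 <-> exists l, a ^+ l * x = 0.
Proof.
rewrite -(rmorph0 to_loc) frac_eq !expr0.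
by split=> -[l e]; exists l; move: e; rewrite !mul1r subr0.
Qed.

Definition loc_inv n : loc a := frac a 1 n.

Lemma loc_invK n : loc_inv n * to_loc a ^+ n = 1.
Proof.
rewrite -rmorphXn fracM mul1r; apply/frac_eq; exists 0%N.
by rewrite addn0 expr0 !mul1r mulr1 subrr.
Qed.

Lemma loc_invKx n x : loc_inv n * (to_loc a ^+ n * x) = x.
Proof. by rewrite mulrA loc_invK mul1r. Qed.

Lemma fracE x n : to_loc a ^+ n * frac a x n = to_loc x.
Proof.
rewrite -rmorphXn fracM add0n; apply/frac_eq; exists 0%N.
by rewrite !expr0 !mul1r subrr.
Qed.

Lemma loc_clear z : exists n x, to_loc a ^+ n * z = to_loc x.
Proof. by elim/loc_ind: z => x n; exists n, x; apply: fracE. Qed.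

Lemma loc_clear_fin (T : finType) (z : T -> loc a) :
  exists n (x : T -> R), forall i, to_loc a ^+ n * z i = to_loc (x i).
Proof.
have /choice[nx nxE] : forall i, exists nx : nat * R,
    to_loc a ^+ nx.1 * z i = to_loc nx.2.
  by move=> i; have [n [x e]] := loc_clear (z i); exists (n, x).
pose n := \sum_i (nx i).1.
exists n, (fun i => a ^+ (n - (nx i).1) * (nx i).2) => i.
rewrite rmorphM /= -nxE rmorphXn mulrA -exprD subnK //.
by rewrite /n (bigD1 i) //= leq_addr.
Qed.

Lemma to_loc_eq0_fin (T : finType) (x : T -> R) :
  (forall i, to_loc (x i) = 0) -> exists l, forall i, a ^+ l * x i = 0.
Proof.
move=> x0; have /choice[l lE] : forall i, exists l, a ^+ l * x i = 0.
  by move=> i; apply/to_loc_eq0.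
exists (\sum_i l i)%N => i.
by rewrite (bigD1 i) //= exprD mulrAC lE mul0r.
Qed.

End LocalizationTheory.
Arguments to_loc {R} a x.

Lemma loc_map_to_loc (R S : comPzRingType) (f : {rmorphism R -> S}) a x :
  loc_map f a (to_loc a x) = to_loc (f a) (f x).
Proof. exact: loc_mapE. Qed.

(** * Flatness of a localized module with a given presentation *)

Section LocalizedModule.
Variables (A B : comPzRingType) (F : {rmorphism A -> B}) (a : A).
Variables (r s : nat) (e : 'I_r -> B) (N : 'M[A]_(r, s)).
Local Notation Fa := (loc_map F a).
Local Notation Ba := (restr (loc_map F a)).
Local Notation ea := (fun j => to_loc (F a) (e j) : Ba).

Lemma restr_scaleE (c : loc a) (x : Ba) : c *: x = Fa c * (x : loc (F a)).
Proof. by []. Qed.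

(** Generation of the localization at [b], with denominators cleared. The element [b] may differ
    from the [a] of the section: [flat_splitting] uses both. *)
Definition generates_at (b : A) : Prop := forall p, exists l (c : 'I_r -> A),
  F b ^+ l * p = \sum_j F (c j) * e j.

Lemma generates_loc : generates_at a ->
  forall z : Ba, exists c : 'I_r -> loc a, z = \sum_j c j *: ea j.
Proof.
move=> gen z; have [n [p zE]] := @loc_clear _ (F a) z.
have [l [c cE]] := gen p.
exists (fun j => loc_inv a (l + n) * to_loc a (c j)).
under eq_bigr => j _ do rewrite -scalerA.
rewrite -scaler_sumr.
have -> : \sum_j to_loc a (c j) *: ea j = to_loc a a ^+ (l + n) *: z.
  rewrite restr_scaleE exprD rmorphM !rmorphXn /= !loc_map_to_loc.
  rewrite -mulrA zE -rmorphXn -rmorphM cE rmorph_sum; apply: eq_bigr => j _.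
  by rewrite restr_scaleE loc_map_to_loc -rmorphM.
by rewrite scalerA loc_invK scale1r.
Qed.

Lemma generates_module_finite : generates_at a -> module_finite Ba.
Proof.
move=> gen; exists r, ea => z; have [c ->] := generates_loc gen z.
by exists c.
Qed.

Hypothesis relN : forall c : 'cV[A]_r, \sum_j F (c j 0) * e j = 0 ->
  exists v, c = N *m v.

(** Localization is exact: clearing denominators and multiplying by a further power of [a] gives a
    relation over [A], to which [relN] applies. *)
Lemma relations_loc (c : 'cV[loc a]_r) : \sum_j c j 0 *: ea j = 0 ->
  exists v, c = map_mx (to_loc a) N *m v.
Proof.
move=> c0; have [n [x xE]] := loc_clear_fin (fun j => c j 0).
have : to_loc (F a) (\sum_j F (x j) * e j) = 0.
  rewrite rmorph_sum -[RHS](scaler0 Ba (to_loc a a ^+ n)) -[in RHS]c0 scaler_sumr.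
  apply: eq_bigr => j _.
  by rewrite scalerA xE restr_scaleE loc_map_to_loc -rmorphM.
move=> /to_loc_eq0[l]; rewrite mulr_sumr => el.
have [|v vE] := relN (c := \col_j (a ^+ l * x j)).
  by rewrite -[RHS]el; apply: eq_bigr => j _; rewrite mxE rmorphM rmorphXn mulrA.
exists (loc_inv a (l + n) *: map_mx (to_loc a) v).
rewrite -scalemxAr -map_mxM -vE; apply/matrixP => j q.
rewrite !mxE ord1 rmorphM /= -xE rmorphXn /= [X in _ * X]mulrA -exprD.
by rewrite loc_invKx.
Qed.

Hypothesis Ne : forall q, \sum_j F (N j q) * e j = 0.

(** Over the localization [D] is invertible, and [E] divided by [D] kills the relations while fixing
    the [e j] in the module. It therefore defines linear coordinates, which form a dual basis. *)
Lemma splitting_flat E X (D w : A) l : generates_at a ->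
  a ^+ l *: (E *m N) = 0 -> D%:M - E = N *m X -> D * w = a -> flat Ba.
Proof.
move=> gen EN DE Dw.
pose D' := to_loc a w * loc_inv a 1.
have DD : D' * to_loc a D = 1.
  by rewrite mulrAC -rmorphM [w * D]mulrC Dw mulrC; apply: (loc_invK a 1).
pose Ea := map_mx (to_loc a) E; pose Na := map_mx (to_loc a) N.
have EN0 : Ea *m Na = 0.
  rewrite -map_mxM; apply/matrixP => i j; rewrite !mxE.
  apply/to_loc_eq0; exists l.
  by have /matrixP/(_ i j) := EN; rewrite !mxE.
have Er (c : 'cV[loc a]_r) : \sum_j c j 0 *: ea j = 0 -> Ea *m c = 0.
  by move=> /relations_loc[v ->]; rewrite mulmxA EN0 mul0mx.
have Ne0 q : \sum_j Na j q *: ea j = 0.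
  rewrite -[RHS](rmorph0 (to_loc (F a))) -(Ne q) rmorph_sum.
  by apply: eq_bigr => j _; rewrite mxE restr_scaleE loc_map_to_loc -rmorphM.
have /choice[c cE] := generates_loc gen.
pose cv z : 'cV_r := \col_j c z j.
(* The chosen coordinates [c z] need not be linear in [z]. Two choices differ by a relation, which
   [Ea] kills, so [phi] is linear. *)
pose phi z j := D' * (Ea *m cv z) j 0.
(* [D - E] equals [N X] and the columns of [N] are relations, so [E] acts on the generators as
   [D]. *)
have EE i : \sum_j Ea j i *: ea j = to_loc a D *: ea i.
  have -> : Ea = (to_loc a D)%:M - Na *m map_mx (to_loc a) X.
    by rewrite -map_mxM -DE map_mxB map_scalar_mx subKr.
  under eq_bigr => j _ do rewrite !mxE scalerBl.
  rewrite sumrB (bigD1 i) //= eqxx mulr1n big1 => [|j /negbTE ->]; last first.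
    by rewrite mulr0n scale0r.
  rewrite addr0 [X in _ - X](_ : _ = 0) ?subr0 //.
  under eq_bigr => j _ do rewrite scaler_suml.
  rewrite exchange_big big1 //= => q _.
  under eq_bigr => j _ do rewrite mulrC -scalerA.
  rewrite -[RHS](scaler0 Ba (map_mx (to_loc a) X q i)) -[in RHS](Ne0 q).
  rewrite [RHS]scaler_sumr.
  by [].
apply: (@flat_dual_basis _ _ _ ea phi) => [j b x y|x].
  suff e1 : Ea *m (cv (b *: x + y) - b *: cv x - cv y) = 0.
    have {}e1 : Ea *m cv (b *: x + y) = b *: (Ea *m cv x) + Ea *m cv y.
      by apply/subr0_eq; rewrite opprD addrA -e1 !mulmxBr -scalemxAr.
    by rewrite /phi e1 mxE [(b *: (Ea *m _)) _ _]mxE mulrDr mulrCA.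
  apply: Er; under eq_bigr => i _ do rewrite !mxE !scalerBl -scalerA.
  by rewrite !sumrB -scaler_sumr -!cE -addrA -opprD subrr.
transitivity (D' *: \sum_i c x i *: (to_loc a D *: ea i) : Ba).
  under eq_bigr => i _ do rewrite scalerA mulrC -scalerA.
  by rewrite -scaler_sumr scalerA DD scale1r -cE.
rewrite scaler_sumr.
transitivity (\sum_j \sum_i (D' * (Ea j i * c x i)) *: ea j).
  rewrite exchange_big; apply: eq_bigr => i _; rewrite -EE !scaler_sumr.
  by apply: eq_bigr => j _; rewrite !scalerA -mulrA [c x i * _]mulrC.
apply: eq_bigr => j _; rewrite /phi mxE mulr_sumr scaler_suml.
by apply: eq_bigr => i _; rewrite [cv x i 0]mxE.
Qed.

(** By [flat_relations] the [e j] are combinations with coefficient vectors in the left kernel of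
    [N]. Expanding in the generators gives [M] with [M N = 0] that acts on the [e j] as
    [d = a ^+ n * b ^+ n']. Up to a power of [a] the columns of [d - M] are relations, so [d - M]
    becomes [N Y]; multiplying by [N] on the right removes [M]. *)
Lemma flat_splitting b : flat Ba -> generates_at b ->
  exists n n' Y, (a ^+ n * b ^+ n') *: N = N *m Y *m N.
Proof.
move=> flatB gen; pose Na := map_mx (to_loc a) N.
have Ne0 q : \sum_j Na j q *: ea j = 0.
  rewrite -[RHS](rmorph0 (to_loc (F a))) -(Ne q) rmorph_sum.
  by apply: eq_bigr => j _; rewrite mxE restr_scaleE loc_map_to_loc -rmorphM.
have [t [tN tE]] := flat_relations flatB Ne0.
(* Induction on the terms of [t]. Powers of [a] clear denominators; powers of [b] come from
   generation at [b]. *)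
have [n [n' [M [MN ME]]]] : exists n n' (M : 'M[A]_r), M *m N = 0 /\
    forall j, to_loc (F a) (F (a ^+ n * b ^+ n')) * (\sum_(p <- t) p.1 0 j *: p.2)
      = to_loc (F a) (\sum_i F (M i j) * e i).
  elim: t tN {tE} => [|[kap z] t IH] tN.
    exists 0%N, 0%N, 0; split=> [|j]; first by rewrite mul0mx.
    rewrite big_nil mulr0 big1 ?rmorph0 // => i _.
    by rewrite mxE rmorph0 mul0r.
  have [|n [n' [M [MN ME]]]] := IH.
    by move=> p pt; apply: tN; rewrite inE pt orbT.
  have /= kN := tN (kap, z) (mem_head _ _).
  have [n1 [k kE]] := loc_clear_fin (fun j => kap 0 j).
  have [n2 kN2] : exists l, forall q, a ^+ l * (\sum_j k j * N j q) = 0.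
    apply: to_loc_eq0_fin => q; rewrite rmorph_sum.
    transitivity (to_loc a a ^+ n1 * (kap *m Na) 0 q); last by rewrite kN mxE mulr0.
    rewrite mxE mulr_sumr; apply: eq_bigr => j _.
    by rewrite mxE rmorphM /= -kE mulrA.
  have [n3 [x xE]] := @loc_clear _ (F a) z.
  have [m' [c cE]] := gen x.
  (* One term contributes a matrix of rank one: the coordinates of the numerator of [z] times the
     cleared kernel vector. The factor [a ^+ n2] is needed because the product of this vector with
     [N] is zero only after localization. *)
  pose M1 : 'M[A]_r := \matrix_(i, j) (c i * (a ^+ n2 * k j)).
  have M1N : M1 *m N = 0.
    apply/matrixP => i q; rewrite !mxE -[RHS](mulr0 (c i)) -[in RHS](kN2 q).
    by rewrite !mulr_sumr; apply: eq_bigr => j _; rewrite mxE; ring.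
  pose m := (n1 + n2 + n3)%N.
  have M1E j : to_loc (F a) (F (a ^+ m * b ^+ m')) * (kap 0 j *: z)
      = to_loc (F a) (\sum_i F (M1 i j) * e i).
    transitivity (to_loc (F a) (F (a ^+ n2 * k j)) * to_loc (F a) (F b ^+ m' * x)).
      have kF : to_loc (F a) (F a) ^+ n1 * Fa (kap 0 j) = to_loc (F a) (F (k j)).
        rewrite -[to_loc _ (F (k j))]loc_map_to_loc -kE.
        by rewrite rmorphM rmorphXn /= loc_map_to_loc.
      rewrite restr_scaleE /m !exprD !(rmorphM, rmorphXn) /= -kF -xE.
      by ring.
    rewrite cE -rmorphM mulr_sumr; congr to_loc; apply: eq_bigr => i _.
    by rewrite mxE [F (c i * _)]rmorphM; ring.
  exists (n + m)%N, (n' + m')%N, ((a ^+ m * b ^+ m') *: M + (a ^+ n * b ^+ n') *: M1).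
  split=> [|j]; first by rewrite mulmxDl -!scalemxAl MN M1N !scaler0 addr0.
  rewrite big_cons /=.
  have -> : \sum_i F (((a ^+ m * b ^+ m') *: M + (a ^+ n * b ^+ n') *: M1) i j) * e i
     = F (a ^+ m * b ^+ m') * (\sum_i F (M i j) * e i)
     + F (a ^+ n * b ^+ n') * (\sum_i F (M1 i j) * e i).
    rewrite !mulr_sumr -big_split; apply: eq_bigr => i _.
    by rewrite !mxE rmorphD !rmorphM mulrDl !mulrA.
  set S := \sum_(p <- t) _ in ME *; set S1 := \sum_i _ in ME *.
  set S2 := \sum_i _ in M1E *.
  transitivity (to_loc (F a) (F (a ^+ m * b ^+ m')) * to_loc (F a) S1 +
    to_loc (F a) (F (a ^+ n * b ^+ n')) * to_loc (F a) S2).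
    rewrite -ME -M1E mulrDr addrC.
    have -> : a ^+ (n + m) * b ^+ (n' + m') =
      a ^+ n * b ^+ n' * (a ^+ m * b ^+ m') by rewrite !exprD; ring.
    rewrite [F (_ * _)]rmorphM [to_loc _ (_ * _)]rmorphM.
    by congr (_ + _); rewrite !mulrA // [_ * to_loc _ (F (a ^+ n * _))]mulrC.
  by rewrite -!rmorphM -rmorphD.
have [l lE] : exists l, forall j : 'I_r, F a ^+ l *
    (F (a ^+ n * b ^+ n') * e j - \sum_i F (M i j) * e i) = 0.
  apply: to_loc_eq0_fin => j.
  by rewrite rmorphB /= -ME -tE [to_loc _ (_ * _)]rmorphM subrr.
pose d := a ^+ n * b ^+ n'.
have /choice[v vE] : forall j : 'I_r, exists v,
    \col_i (a ^+ l * (d *+ (i == j) - M i j)) = N *m v.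
  move=> j; apply: relN; rewrite -[RHS](lE j) mulrBr.
  under eq_bigr => i _ do
    rewrite mxE rmorphM rmorphB rmorphXn rmorphMn mulrBr mulrBl /=.
  rewrite sumrB (bigD1 j) //= eqxx mulr1n big1 => [|i /negbTE ->]; last first.
    by rewrite mulr0n mulr0 mul0r.
  rewrite addr0 mulrA; congr (_ - _); rewrite mulr_sumr.
  by apply: eq_bigr => i _; rewrite mulrA.
pose Y := \matrix_(i, j) v j i 0.
have NY : N *m Y = a ^+ l *: (d%:M - M).
  apply/matrixP => i j; have /matrixP/(_ i 0) := vE j; rewrite !mxE => ->.
  by apply: eq_bigr => q _; rewrite !mxE.
exists (l + n)%N, n', Y; rewrite NY -scalemxAl mulmxBl MN subr0 mul_scalar_mx.
by rewrite scalerA exprD mulrA.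
Qed.

End LocalizedModule.

(** The determinant trick: multiplication by [x] on module generators has a matrix over the
    localization of [A]. After clearing denominators the determinant kills all generators, hence
    [1]. *)
Lemma finite_integral (A B : comPzRingType) (F : {rmorphism A -> B}) a x :
  module_finite (restr (loc_map F a)) ->
  exists d n l (C : 'M[A]_d),
    F a ^+ l * \det ((F a ^+ n * x)%:M - map_mx F C) = 0.
Proof.
move=> [d [e gen]].
have /choice[c cE] : forall j, exists c : 'I_d -> loc a,
    (to_loc (F a) x * (e j : loc (F a)) : restr (loc_map F a)) = \sum_i c i *: e i.
  by move=> j; apply: gen.
have [n [C CE]] := loc_clear_fin (fun p : 'I_d * 'I_d => c p.1 p.2).
pose M : 'M[A]_d := \matrix_(i, j) C (i, j).
exists d, n.
suff /to_loc_eq0[l lE] : to_loc (F a) (\det ((F a ^+ n * x)%:M - map_mx F M)) = 0.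
  by exists l, M.
rewrite -det_map_mx; set T := map_mx _ _.
pose ec : 'cV[loc (F a)]_d := \col_j e j.
have Te : T *m ec = 0.
  rewrite /T map_mxB map_scalar_mx mulmxBl mul_scalar_mx; apply/matrixP => j q.
  rewrite !mxE rmorphM -mulrA -/(to_loc (F a)) cE mulr_sumr -sumrB big1 // => i _.
  rewrite !mxE restr_scaleE mulrA.
  have := congr1 (loc_map F a) (CE (j, i)).
  rewrite rmorphM rmorphXn /= !loc_map_to_loc => e1.
  by rewrite rmorphXn /= e1 subrr.
have de j : \det T * e j = 0.
  have := congr1 (mulmx (\adj T)) Te.
  rewrite mulmxA mul_adj_mx mul_scalar_mx mulmx0 => /matrixP/(_ j 0).
  by rewrite !mxE.
have [c1 c1E] := gen (1 : loc (F a)).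
rewrite -[LHS]mulr1 c1E mulr_sumr big1 // => i _.
by rewrite restr_scaleE mulrCA de mulr0.
Qed.

(** * Monomial orders and Gröbner bases *)

Section MonomialParts.
Variables (N q : nat) (f : 'I_q -> 'I_N).

Lemma mpartD a b : mpart f (a + b)%MM = (mpart f a + mpart f b)%MM.
Proof. by apply/mnmP => i; rewrite mnmDE !mnmE. Qed.

(** The exponent of the monomial [a] after renaming its variables by [f]; see [renameX]. *)
Definition mpush (a : 'X_{1..q}) : 'X_{1..N} :=
  [multinom (\sum_(i | f i == j) a i)%N | j < N].

Lemma mpush0 : mpush 0%MM = 0%MM.
Proof. by apply/mnmP => j; rewrite mnmE big1 ?mnm0E // => i _; rewrite mnm0E. Qed.

Lemma mpushD a b : mpush (a + b)%MM = (mpush a + mpush b)%MM.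
Proof.
apply/mnmP => j; rewrite mnmDE !mnmE -big_split.
by apply: eq_bigr => i _; rewrite mnmDE.
Qed.

Lemma mpushU i : mpush U_(i)%MM = U_(f i)%MM.
Proof.
apply/mnmP => j; rewrite mnmE mnm1E; have [<-|nij] := eqVneq (f i) j.
  rewrite (bigD1 i) //= mnm1E eqxx big1 // => l /andP[_ /negbTE nl].
  by rewrite mnm1E eq_sym nl.
rewrite big1 // => l /eqP fl; rewrite mnm1E; case: eqVneq => // e.
by rewrite e fl eqxx in nij.
Qed.

Lemma mpushK (fI : injective f) a : mpart f (mpush a) = a.
Proof.
apply/mnmP => i; rewrite !mnmE (bigD1 i) //= big1 ?addn0 // => j /andP[/eqP/fI ->].
by rewrite eqxx.
Qed.

Lemma mpush_out p (g : 'I_p -> 'I_N) a :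
  (forall i j, g i != f j) -> mpart g (mpush a) = 0%MM.
Proof.
move=> ngf; apply/mnmP => i; rewrite !mnmE big1 ?mnm0E // => j.
by rewrite eq_sym (negbTE (ngf _ _)).
Qed.

End MonomialParts.

Section RenameTheory.
Variable k : fieldType.

Lemma comp_rename q N N' (f : 'I_q -> 'I_N) (t : N.-tuple {mpoly k[N']}) p :
  comp_mpoly t (rename f p) = comp_mpoly [tuple tnth t (f i) | i < q] p.
Proof.
rewrite /rename; elim/mpolyind: p => [|c a p _ _ IH]; first by rewrite !comp_mpoly0.
rewrite !comp_mpolyD IH !comp_mpolyZ !comp_mpolyX rmorph_prod.
congr (_ *: _ + _); apply: eq_bigr => i _.
rewrite rmorphXn !tnth_mktuple; congr (_ ^+ _).
by rewrite /= comp_mpolyXU -tnth_nth.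
Qed.

Lemma rename_comp q N N' (f : 'I_q -> 'I_N) (g : 'I_N -> 'I_N') (p : {mpoly k[q]}) :
  rename g (rename f p) = rename (g \o f) p.
Proof.
rewrite [LHS]comp_rename /rename; congr comp_mpoly.
by apply: eq_from_tnth => i; rewrite !tnth_mktuple.
Qed.

Lemma renameZ q N (f : 'I_q -> 'I_N) c (p : {mpoly k[q]}) :
  rename f (c *: p) = c *: rename f p.
Proof. exact: comp_mpolyZ. Qed.

Lemma renameX q N (f : 'I_q -> 'I_N) a :
  rename f ('X_[a] : {mpoly k[q]}) = 'X_[mpush f a].
Proof.
rewrite /rename comp_mpolyX.
under eq_bigr => i _ do rewrite tnth_mktuple mpolyXn.
rewrite -(big_morph (@mpolyX N k) (@mpolyXD N k) (@mpolyX0 N k)).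
congr 'X_[_]; apply/mnmP => j.
rewrite mnm_sumE mnmE [LHS](bigID (fun i => f i == j)) /= [X in (_ + X)%N]big1.
  by rewrite addn0; apply: eq_bigr => i /eqP <-; rewrite mulmnE mnm1E eqxx mul1n.
by move=> i /negbTE; rewrite mulmnE mnm1E => ->.
Qed.

Lemma renameE q N (f : 'I_q -> 'I_N) (p : {mpoly k[q]}) :
  rename f p = \sum_(a <- msupp p) p@_a *: 'X_[mpush f a].
Proof.
rewrite {1}[p]mpolyE raddf_sum; apply: eq_bigr => a _.
by rewrite /= renameZ renameX.
Qed.

Lemma mcoeffMXD n (p : {mpoly k[n]}) a b :
  ('X_[a] * p)@_(a + b) = p@_b.
Proof. by rewrite mulrC mcoeffMX. Qed.

Lemma msupp_mulX n (p : {mpoly k[n]}) a b :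
  b \in msupp ('X_[a] * p) -> exists2 c, c \in msupp p & b = (a + c)%MM.
Proof.
rewrite mulrC (perm_mem (msuppMX _ _)) => /mapP[c cp ->].
by exists c.
Qed.

End RenameTheory.

Section MonomialPreorders.

(** Block orders are built from preorders: an intermediate block does not see all
    the variables, hence is not antisymmetric. *)
Definition monomial_preorder n (T : rel 'X_{1..n}) : Prop :=
  [/\ total T, transitive T,
      forall a b c : 'X_{1..n}, T a b -> T (a + c)%MM (b + c)%MM
    & well_founded (fun a b => ~~ T b a)].

Lemma monomial_order_strict n (T : rel 'X_{1..n}) a b : monomial_order T ->
  ~~ T b a = (a != b) && T a b.
Proof.
move=> [tT aT _ _ _]; apply/idP/andP => [nT|[nab Tab]].
  have := tT a b; rewrite (negbTE nT) orbF => Tab; split=> //.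
  by apply: contraNneq nT => <-; have := tT a a; rewrite orbb.
by apply: contra nab => Tba; apply/eqP/aT; rewrite Tab.
Qed.

Lemma monomial_order_pre n (T : rel 'X_{1..n}) :
  monomial_order T -> monomial_preorder T.
Proof.
move=> T_ok; have [tT aT rT cT wT] := T_ok.
split; [exact: tT | exact: rT | exact: cT | move=> a].
elim/(well_founded_ind wT): a => a IH.
by constructor=> b; rewrite (monomial_order_strict _ _ T_ok) => /IH.
Qed.

Lemma preorder_monomial n (T : rel 'X_{1..n}) :
  monomial_preorder T -> antisymmetric T -> monomial_order T.
Proof.
move=> [tT rT cT wT] aT.
split; [exact: tT | exact: aT | exact: rT | exact: cT | move=> a].
elim/(well_founded_ind wT): a => a IH.
constructor=> b /andP[nab Tab]; apply: IH.
by apply: contra nab => Tba; apply/eqP/aT; rewrite Tab.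
Qed.

Lemma part_preorder N q (f : 'I_q -> 'I_N) (T : rel 'X_{1..q}) :
  monomial_order T -> monomial_preorder (part_order f T).
Proof.
move=> /monomial_order_pre[tT rT cT wT]; split=> [a b|b a c|a b c|a].
- exact: tT.
- exact: rT.
- by rewrite /part_order !mpartD; apply: cT.
- move: {2}(mpart f a) (erefl (mpart f a)) => d; move: a.
  elim/(well_founded_ind wT): d => d IH a e; constructor=> b nT.
  by apply: (IH (mpart f b)) => //; rewrite -e.
Qed.

Lemma block_preorder N q (f : 'I_q -> 'I_N) (T : rel 'X_{1..q})
    (T' : rel 'X_{1..N}) :
  monomial_order T -> monomial_preorder T' ->
  monomial_preorder (block_order f T T').
Proof.
move=> T_ok [tT' rT' cT' wT']; have [tT aT rT cT wT] := T_ok.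
split=> [a b|b a c|a b c|a].
- rewrite /block_order eq_sym; case: eqP => _; first exact: tT'.
  exact: tT.
- rewrite /block_order /part_order.
  have [eab|nab] := eqVneq (mpart f a) (mpart f b).
    by rewrite eab; case: eqP => // _; apply: rT'.
  have [ebc|nbc] := eqVneq (mpart f b) (mpart f c).
    by rewrite -ebc (negbTE nab).
  move=> Tab Tbc; case: eqP => [e|_]; last exact: rT Tbc.
  by case/eqP: nab; apply: aT; rewrite Tab e.
- rewrite /block_order /part_order !mpartD; case: eqP => [->|nab].
    by rewrite eqxx; apply: cT'.
  case: eqP => [e|_]; last exact: cT.
  case: nab; have := congr1 (fun d => d - mpart f c)%MM e.
  by rewrite !addmK.
(* Lexicographic well-foundedness: the outer induction is on the block part, the inner one runs
   along [T'] while that part is fixed. *)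
- move: {2}(mpart f a) (erefl (mpart f a)) => d; move: a.
  elim/(well_founded_ind wT): d => d IH a; elim/(well_founded_ind wT'): a => a IH' e.
  constructor=> b; rewrite /block_order; case: eqP => [e' nT|/eqP nab].
    by apply: IH' => //; rewrite -e'.
  rewrite /part_order (monomial_order_strict _ _ T_ok) => Tba.
  by apply: (IH (mpart f b)) => //; rewrite -e.
Qed.

Lemma block_anti N q (f : 'I_q -> 'I_N) (T : rel 'X_{1..q})
    (T' : rel 'X_{1..N}) a b : monomial_order T ->
  block_order f T T' a b -> block_order f T T' b a ->
  [/\ mpart f a = mpart f b, T' a b & T' b a].
Proof.
move=> [_ aT _ _ _]; rewrite /block_order eq_sym; case: eqP => [->|ne] //.
by move=> Tab Tba; case: ne; apply: aT; apply/andP.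
Qed.

End MonomialPreorders.

(** * Leading monomials and reduction by a Gröbner basis *)

Section LeadingMonomials.
Variables (k : fieldType) (n : nat) (T : rel 'X_{1..n}).
Hypothesis T_ok : monomial_order T.

Lemma order_refl a : T a a.
Proof. by have [tT _ _ _ _] := T_ok; have := tT a a; rewrite orbb. Qed.

(** Were [a] strictly below [0], the multiples [a *+ j] would descend forever, by compatibility with
    addition. *)
Lemma order_ge0 a : T 0%MM a.
Proof.
have [tT aT _ cT wT] := T_ok; apply: contraT => nT.
have Ta0 : T a 0%MM by have := tT 0%MM a; rewrite (negbTE nT).
have [b e] : exists j, (a *+ j)%MM = 0%MM by exists 0%N; rewrite mulm0n.
have wd d : forall j, d = (a *+ j)%MM -> False.
  elim/(well_founded_ind wT): d => d IH j dE.
  apply: (IH (a *+ j.+1)%MM _ j.+1) => //; rewrite dE mulmS.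
  have -> : T (a + a *+ j)%MM (a *+ j)%MM.
    by have := cT _ _ (a *+ j)%MM Ta0; rewrite add0m.
  rewrite andbT; apply: contra nT => /eqP e'.
  have := congr1 (fun d => d - (a *+ j))%MM e'; rewrite addmK => ->.
  have -> : ((a *+ j) - (a *+ j))%MM = 0%MM.
    by apply/mnmP => i; rewrite mnmBE subnn mnm0E.
  exact: order_refl.
by case: (wd _ 0%N (erefl _)).
Qed.

Lemma order_le0 a : T a 0%MM -> a = 0%MM.
Proof.
by have [_ aT _ _ _] := T_ok => Ta0; apply: aT; rewrite Ta0 order_ge0.
Qed.

Lemma max_mon_ge s a : a \in s -> T a (max_mon T s).
Proof.
have [tT _ rT _ _] := T_ok; elim: s => //= b s IH; rewrite inE.
case: ifP => Tb /predU1P[->|/IH] //; first exact: order_refl.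
have := tT b (max_mon T s); rewrite Tb /= => Tmb Ta; exact: rT Tmb.
Qed.

Lemma max_mon_mem s : s != [::] -> max_mon T s \in s.
Proof.
elim: s => //= b [|c s] IH _.
  case: ifP => [/= /order_le0 ->|_]; exact: mem_head.
case: ifP => _; last exact: mem_head.
by rewrite inE IH ?orbT.
Qed.

Lemma lead_mon_ge (p : {mpoly k[n]}) a : a \in msupp p -> T a (lead_mon T p).
Proof. exact: max_mon_ge. Qed.

Lemma lead_mon_mem (p : {mpoly k[n]}) : p != 0 -> lead_mon T p \in msupp p.
Proof. by rewrite -msupp_eq0; apply: max_mon_mem. Qed.

Lemma max_mon_uniq s a : a \in s -> (forall b, b \in s -> T b a) ->
  max_mon T s = a.
Proof.
have [_ aT _ _ _] := T_ok => sa ages; apply: aT.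
rewrite max_mon_ge // ages // max_mon_mem //.
by apply: contraTneq sa => ->.
Qed.

Section Groebner.
Variables (I : ideal {mpoly k[n]}) (G : seq {mpoly k[n]}).
Hypothesis HG : groebner T I G.

Lemma groebner_lead (f : {mpoly k[n]}) : I f -> f != 0 -> exists g c,
  [/\ g \in G, g != 0 & lead_mon T f = (c + lead_mon T g)%MM].
Proof.
move=> If nf; have [_ /(_ 'X_[lead_mon T f])[_ h]] := HG.
have [|s [sG sE]] := h; first by apply: ideal_gen_incl; exists f.
(* Some term of the combination must contain the leading monomial of [f], which is then divisible by
   the leading monomial of an element of [G]. *)
have : exists2 p, p \in s & (p.1 * p.2)@_(lead_mon T f) != 0.
  apply/hasP; apply: contraT => /hasPn ns.
  have := congr1 (mcoeff (lead_mon T f)) sE.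
  rewrite mcoeffX eqxx raddf_sum big_seq big1 => [/eqP|p /ns]; last first.
    by rewrite negbK => /eqP.
  by rewrite oner_eq0.
move=> [p /sG[g [gG ng ->]]]; rewrite -mcoeff_msupp mulrC.
by move=> /msupp_mulX[c _ ->]; exists g, c; rewrite addmC.
Qed.

(** Division by [G] as an induction principle: each reduction stays in [I] and cancels the leading
    term, and an element of [I] can be reduced as long as it is nonzero. *)
Lemma groebner_ind (Q : {mpoly k[n]} -> Prop) : Q 0 ->
  (forall f g c (x : k), I f -> f != 0 -> g \in G -> I g -> g != 0 ->
    lead_mon T f = (c + lead_mon T g)%MM ->
    Q (f - x *: ('X_[c] * g)) -> Q f) ->
  forall f, I f -> Q f.
Proof.
have [tT aT rT cT wT] := T_ok => Q0 QI f.
have [-> //|nf] := eqVneq f 0.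
move: {2}(lead_mon T f) (erefl (lead_mon T f)) => d; move: f nf.
elim/(well_founded_ind wT): d => d IH f nf fd If.
have [g [c [gG ng lf]]] := groebner_lead If nf.
have Ig : I g by apply: HG.1.
pose x := f@_(lead_mon T f) / g@_(lead_mon T g).
apply: (QI f g c x) => //; set f' := f - _.
have [-> //|nf'] := eqVneq f' 0.
have lf' : lead_mon T f' \in msupp f' by apply: lead_mon_mem.
have supp' a : a \in msupp f' -> T a (lead_mon T f).
  move=> /msuppB_le; rewrite mem_cat => /orP[/lead_mon_ge //|].
  move=> /msuppZ_le/msupp_mulX[b bg ->].
  by rewrite lf addmC [(c + _)%MM]addmC; apply/cT/lead_mon_ge.
apply: (IH (lead_mon T f')) => //; last first.
  apply: idealB => //; rewrite -mul_mpolyC; apply: idealM; exact: idealM.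
rewrite -fd supp' // andbT; apply: contraTneq lf' => ->.
rewrite mcoeff_msupp negbK mcoeffB mcoeffZ {2}lf mcoeffMXD /x.
by rewrite divfK ?subrr // -mcoeff_msupp lead_mon_mem.
Qed.

End Groebner.
End LeadingMonomials.

(** * Pure powers and the monomials generating B' *)

Section XPolynomials.
Variables (k : fieldType) (m n : nat).
Local Notation yv := (@yvar m n).
Local Notation xv := (@xvar m n).
Local Notation yin := (@yincl k m n).
Local Notation xm a := ('X_[mpush xv a] : {mpoly k[m + n]}).

Lemma yv_inj : injective yv. Proof. exact: lshift_inj. Qed.
Lemma xv_inj : injective xv. Proof. exact: rshift_inj. Qed.
Lemma xv_yv i j : xv i != yv j. Proof. by rewrite eq_rlshift. Qed.
Lemma yv_xv i j : yv i != xv j. Proof. by rewrite eq_lrshift. Qed.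

Lemma is_y_xv i : is_y (xv i) = false.
Proof. by apply/codomP => -[j /eqP]; rewrite (negbTE (xv_yv _ _)). Qed.

Lemma mpart_x_push a : mpart xv (mpush xv a) = a.
Proof. exact/mpushK/xv_inj. Qed.
Lemma mpart_y_push a : mpart yv (mpush yv a) = a.
Proof. exact/mpushK/yv_inj. Qed.
Lemma mpart_xy_push a : mpart xv (mpush yv a) = 0%MM.
Proof. by apply: mpush_out => i j; rewrite xv_yv. Qed.
Lemma mpart_yx_push a : mpart yv (mpush xv a) = 0%MM.
Proof. by apply: mpush_out => i j; rewrite yv_xv. Qed.

Lemma xy_ext (a b : 'X_{1..m + n}) :
  mpart xv a = mpart xv b -> mpart yv a = mpart yv b -> a = b.
Proof.
move=> /mnmP ex /mnmP ey; apply/mnmP => j.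
case: (split_ordP j) => i ->; [have := ey i | have := ex i]; by rewrite !mnmE.
Qed.

Lemma xy_decomp (a : 'X_{1..m + n}) :
  (mpush yv (mpart yv a) + mpush xv (mpart xv a))%MM = a.
Proof.
apply: xy_ext; rewrite mpartD.
  by rewrite mpart_xy_push mpart_x_push add0m.
by rewrite mpart_y_push mpart_yx_push addm0.
Qed.

Lemma yinZ c p : yin (c *: p) = c *: yin p.
Proof. exact: renameZ. Qed.

Lemma mpolyX_xy (a : 'X_{1..m + n}) :
  'X_[a] = yin 'X_[mpart yv a] * xm (mpart xv a).
Proof. by rewrite /yin renameX -mpolyXD xy_decomp. Qed.

Lemma xy_order_ok Tx Ty : monomial_order Tx -> monomial_order Ty ->
  monomial_order (xy_order Tx Ty : rel 'X_{1..m + n}).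
Proof.
move=> Tx_ok Ty_ok; apply: preorder_monomial.
  exact: (block_preorder _ Tx_ok (part_preorder _ Ty_ok)).
move=> a b /andP[Tab Tba]; have [ex Tyab Tyba] := block_anti Tx_ok Tab Tba.
apply: xy_ext => //; have [_ aT _ _ _] := Ty_ok; apply: aT.
by rewrite /part_order in Tyab Tyba; rewrite Tyab.
Qed.

Lemma mcoeff_xcoef c (p : {mpoly k[m + n]}) b :
  (xcoef c p)@_b = p@_(mpush yv b + mpush xv c)%MM.
Proof.
set d := (_ + _)%MM.
have ed a : ((mpart xv a == c) && (mpart yv a == b)) = (a == d).
  apply/andP/eqP => [[/eqP ec /eqP eb]|->]; first by rewrite /d -ec -eb xy_decomp.
  rewrite !mpartD mpart_xy_push mpart_x_push mpart_y_push mpart_yx_push.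
  by rewrite add0m addm0 !eqxx.
rewrite /xcoef raddf_sum /= big_mkcond /=.
have [ds|ds] := boolP (d \in msupp p); last first.
  rewrite (memN_msupp_eq0 ds) big_seq big1 // => a ap; case: ifP => // ac.
  rewrite mcoeffZ mcoeffX; case: eqP => [ab|]; rewrite ?mulr0 //.
  by move: (ed a) ds; rewrite ac ab eqxx => /esym/eqP <-; rewrite ap.
rewrite (bigD1_seq d) ?msupp_uniq //= big1 => [|a nad].
  have /andP[-> /eqP yd] : (mpart xv d == c) && (mpart yv d == b) by rewrite ed.
  by rewrite mcoeffZ mcoeffX yd eqxx mulr1 addr0.
case: ifP => // ac; rewrite mcoeffZ mcoeffX; move: (ed a); rewrite ac /= => ->.
by rewrite (negbTE nad) mulr0.
Qed.

Lemma xcoefB c (p q : {mpoly k[m + n]}) : xcoef c (p - q) = xcoef c p - xcoef c q.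
Proof. by apply/mpolyP => b; rewrite mcoeffB !mcoeff_xcoef mcoeffB. Qed.

Lemma xcoefZ c x (p : {mpoly k[m + n]}) : xcoef c (x *: p) = x *: xcoef c p.
Proof. by apply/mpolyP => b; rewrite mcoeffZ !mcoeff_xcoef mcoeffZ. Qed.

Lemma xcoef0 c : xcoef c (0 : {mpoly k[m + n]}) = 0.
Proof. by apply/mpolyP => b; rewrite mcoeff_xcoef !mcoeff0. Qed.

Lemma xcoef_mulX c d (p : {mpoly k[m + n]}) :
  xcoef (mpart xv c + d) ('X_[c] * p) = 'X_[mpart yv c] * xcoef d p.
Proof.
apply/mpolyP => b; rewrite mcoeff_xcoef.
have [cb|ncb] := boolP (mpart yv c <= b)%MM.
  rewrite -(submK cb) addmC [in RHS]addmC mcoeffMXD mcoeff_xcoef.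
  set b' := (b - _)%MM.
  have -> : (mpush xv (mpart xv c + d) + mpush yv (b' + mpart yv c) =
      c + (mpush yv b' + mpush xv d))%MM.
    rewrite !mpushD -{3}(xy_decomp c); apply/mnmP => i; rewrite !mnmDE; ring.
  by rewrite mcoeffMXD.
transitivity (0 : k).
  apply: memN_msupp_eq0; apply: contra ncb => /msupp_mulX[a _ e].
  have := congr1 (mpart yv) e.
  by rewrite !mpartD mpart_y_push mpart_yx_push addm0 => ->; apply: lem_addr.
symmetry; apply: memN_msupp_eq0; apply: contra ncb => /msupp_mulX[a _ ->].
exact: lem_addr.
Qed.

Lemma yin_xcoef c (p : {mpoly k[m + n]}) : yin (xcoef c p) * xm c =
  \sum_(a <- msupp p | mpart xv a == c) p@_a *: 'X_[a].
Proof.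
rewrite /xcoef raddf_sum mulr_suml; apply: eq_bigr => a /eqP <-.
by rewrite /= /yin renameZ -scalerAl -mpolyX_xy.
Qed.

Lemma xcoef_supp c (p : {mpoly k[m + n]}) : xcoef c p != 0 ->
  exists2 a, a \in msupp p & mpart xv a = c.
Proof.
rewrite -msupp_eq0; case E: (msupp _) => [//|b s] _.
have : b \in msupp (xcoef c p) by rewrite E mem_head.
rewrite mcoeff_msupp mcoeff_xcoef -mcoeff_msupp => h; eexists; first exact: h.
by rewrite mpartD mpart_xy_push mpart_x_push add0m.
Qed.

Lemma mpart_lead_mon Tx Ty (p : {mpoly k[m + n]}) : monomial_order Tx ->
    monomial_order Ty -> p != 0 ->
  mpart xv (lead_mon (xy_order Tx Ty) p) = lead_mon_x Tx p.
Proof.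
move=> Tx_ok Ty_ok np; have T_ok := xy_order_ok Tx_ok Ty_ok.
apply/esym/(max_mon_uniq Tx_ok); first exact/map_f/(lead_mon_mem T_ok).
move=> _ /mapP[a /(lead_mon_ge T_ok) Ta ->]; move: Ta; rewrite /xy_order /block_order.
by case: eqP => [-> _|//]; apply: (order_refl Tx_ok).
Qed.

Section GroebnerX.
Variables (I : ideal {mpoly k[m + n]}) (Tx : rel 'X_{1..n}) (Ty : rel 'X_{1..m}).
Hypotheses (Tx_ok : monomial_order Tx) (Ty_ok : monomial_order Ty).
Variable G : seq {mpoly k[m + n]}.
Hypothesis HG : groebner (xy_order Tx Ty) I G.
Local Notation T_ok := (xy_order_ok Tx_ok Ty_ok).
Local Notation xdeg i d := (U_(i) *+ d)%MM.

Lemma pure_power_sum (i : 'I_n) (c e : 'X_{1..n}) d : (c + e)%MM = xdeg i d ->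
  e = (xdeg i (e i)) /\ c = xdeg i (c i).
Proof.
move=> /mnmP ce; split; apply/mnmP => j; have := ce j;
  rewrite !mulmnE mnmDE mnm1E; case: eqP => [<-|_]; rewrite ?mul1n ?mul0n //.
- by move/eqP; rewrite addn_eq0 => /andP[_ /eqP].
- by move/eqP; rewrite addn_eq0 => /andP[/eqP].
Qed.

(** Reducing [f] by [G] changes its coefficient at [x_i ^ d] only by multiples of
    elements of [J] and of leading coefficients of pure powers of [x_i]. *)
Lemma lead_coef_pure_powers (K : ideal {mpoly k[m]}) (i : 'I_n) d f :
    (forall p, I (yin p) -> K p) ->
    (forall g, g \in pure_powers Tx G i -> K (xcoef (lead_mon_x Tx g) g)) ->
    I f -> (forall a, a \in msupp f -> Tx (mpart xv a) (xdeg i d)) ->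
  K (xcoef (xdeg i d) f).
Proof.
move=> JK GK If; move: f If.
apply: (groebner_ind T_ok HG) => [_|f g c x If nf gG Ig ng lf IH supp].
  by rewrite xcoef0; apply: ideal0.
(* If the coefficient is nonzero, the bound on the support makes [x_i ^ d] the [x]-part of the
   leading monomial, so the reducer [g] has a power of [x_i] as its leading monomial in [x]. *)
have [->|/xcoef_supp[a af ea]] := eqVneq (xcoef (xdeg i d) f) 0; first exact: ideal0.
have lx : mpart xv (lead_mon (xy_order Tx Ty) f) = xdeg i d.
  have [_ aT _ _ _] := Tx_ok; apply: aT; rewrite supp ?(lead_mon_mem T_ok) //=.
  have := lead_mon_ge T_ok af; rewrite /xy_order /block_order -ea.
  by case: eqP => [-> _|//]; apply: (order_refl Tx_ok).
have le : (mpart xv c + lead_mon_x Tx g)%MM = xdeg i d.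
  by rewrite -(mpart_lead_mon Tx_ok Ty_ok ng) -mpartD -lf.
have fE : f = f - x *: ('X_[c] * g) + x *: ('X_[c] * g) by rewrite subrK.
have -> : xcoef (xdeg i d) f = xcoef (xdeg i d) (f - x *: ('X_[c] * g)) +
    x *: ('X_[mpart yv c] * xcoef (lead_mon_x Tx g) g).
  by rewrite xcoefB xcoefZ -{3}le xcoef_mulX subrK.
apply: idealD.
  apply: IH => b /msuppB_le; rewrite mem_cat => /orP[/supp //|].
  move=> /msuppZ_le/msupp_mulX[b' bg ->]; rewrite mpartD -le.
  rewrite addmC [(mpart xv c + _)%MM]addmC.
  have [_ _ _ cT _] := Tx_ok; apply: cT.
  by apply: (max_mon_ge Tx_ok); apply: map_f.
rewrite -mul_mpolyC; do 2!apply: idealM.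
have [e _] := pure_power_sum le.
(* A positive exponent makes [g] a pure power. If it is zero, [g] lies in [k[y]] and is its own
   coefficient, an element of [J]. *)
have [e0|e0] := eqVneq (lead_mon_x Tx g i) 0%N; last first.
  apply: GK; rewrite mem_filter gG andbT; apply/and3P; split; last exact/eqP.
    apply/allPn; exists (lead_mon (xy_order Tx Ty) g).
      exact: (lead_mon_mem T_ok).
    apply/forallPn; exists (xv i); rewrite negb_imply is_y_xv andbT.
    move: e0; rewrite -(mpart_lead_mon Tx_ok Ty_ok ng).
    by rewrite mnmE.
  by rewrite lt0n.
rewrite e0 mulm0n in e; apply: JK; rewrite e.
have -> : yin (xcoef 0%MM g) = g; last by [].
have := yin_xcoef 0%MM g; rewrite mpush0 mpolyX0 mulr1 => ->.
rewrite [RHS]mpolyE big_seq_cond [RHS]big_seq; apply: eq_bigl => a'.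
apply: andb_idr => ag; apply/eqP; apply: (order_le0 Tx_ok).
by rewrite -e; apply: max_mon_ge => //; apply: map_f.
Qed.

(** A polynomial in [k[y, x_i]] has only powers of [x_i] as its [x]-monomials, the highest being the
    [Tx]-largest. Thus [lead_coef_pure_powers] applies, in contrapositive form. *)
Lemma locus_pure_power (K : ideal {mpoly k[m]}) i c :
    (forall p, I (yin p) -> K p) -> nonfinite_ideal I i c -> ~ K c ->
  exists2 g, g \in pure_powers Tx G i & ~ K (xcoef (lead_mon_x Tx g) g).
Proof.
move=> JK [f [If fv ->]] nK; apply: contrapT => ng; apply: nK.
apply: (lead_coef_pure_powers JK) => // [g gG|a af].
  by apply: contrapT => nKg; apply: ng; exists g.
have -> : mpart xv a = xdeg i (a (xv i)).
  apply/mnmP => j; rewrite mnmE mulmnE mnm1E; case: eqP => [->|nij].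
    by rewrite mul1n.
  have /allP/(_ a af)/forallP/(_ (xv j)) := fv.
  rewrite inE is_y_xv /= (inj_eq xv_inj) => /implyP h.
  by apply/eqP; apply: contraT => /h /eqP e; case: nij.
have : (a (xv i) <= \max_(b <- msupp f) b (xv i))%N.
  exact: (leq_bigmax_seq (F := fun b : 'X_{1..m + n} => b (xv i)) a af).
move=> /subnK <-; set e := (_ - _)%N.
have -> : xdeg i (e + a (xv i)) = (xdeg i e + xdeg i (a (xv i)))%MM.
  by apply/mnmP => j; rewrite mnmDE !mulmnE mulnDr.
rewrite -{1}[xdeg i (a (xv i))]add0m.
by have [_ _ _ cT _] := Tx_ok; apply/cT/(order_ge0 Tx_ok).
Qed.

Section Generation.
Variables (r : nat) (ms : 'I_r -> 'X_{1..n}) (a : {mpoly k[m]}).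
Hypothesis Hms : enum_module_monomials Tx G ms.
Hypothesis Ha : forall i, exists g w, g \in pure_powers Tx G i /\
  a = w * xcoef (lead_mon_x Tx g) g.

(** The class of [p] lies in [B'] after inverting [a]. *)
Definition reducible p := exists l (c : 'I_r -> {mpoly k[m]}),
  I (yin a ^+ l * p - \sum_j yin (c j) * xm (ms j)).

Lemma reducibleD p q : reducible p -> reducible q -> reducible (p + q).
Proof.
move=> [l [c cI]] [l' [c' cI']]; exists (l + l')%N.
exists (fun j => a ^+ l' * c j + a ^+ l * c' j).
have -> : yin a ^+ (l + l') * (p + q) -
    \sum_j yin (a ^+ l' * c j + a ^+ l * c' j) * xm (ms j) =
  yin a ^+ l' * (yin a ^+ l * p - \sum_j yin (c j) * xm (ms j)) +
  yin a ^+ l * (yin a ^+ l' * q - \sum_j yin (c' j) * xm (ms j)).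
  have -> : \sum_j yin (a ^+ l' * c j + a ^+ l * c' j) * xm (ms j) =
    yin a ^+ l' * (\sum_j yin (c j) * xm (ms j)) +
    yin a ^+ l * (\sum_j yin (c' j) * xm (ms j)).
    rewrite !mulr_sumr -big_split; apply: eq_bigr => j _.
    by rewrite rmorphD !rmorphM !rmorphXn mulrDl !mulrA.
  by rewrite exprD; ring.
by apply: idealD; apply: idealM.
Qed.

Lemma reducibleM q p : reducible p -> reducible (yin q * p).
Proof.
move=> [l [c cI]]; exists l, (fun j => q * c j).
have -> : \sum_j yin (q * c j) * xm (ms j) =
    yin q * (\sum_j yin (c j) * xm (ms j)).
  by rewrite mulr_sumr; apply: eq_bigr => j _; rewrite rmorphM mulrA.
by rewrite mulrCA -mulrBr; apply: idealM.
Qed.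

Lemma reducible_sum (S : Type) (s : seq S) (Q : pred S) F :
  (forall i, Q i -> reducible (F i)) -> reducible (\sum_(i <- s | Q i) F i).
Proof.
move=> FR; elim/big_rec: _ => [|i x Qi]; last exact/reducibleD/FR.
exists 0%N, (fun=> 0); rewrite mulr0 sub0r big1 ?oppr0; first exact: ideal0.
by move=> j _; rewrite rmorph0 mul0r.
Qed.

Lemma reducible_mod p q : I (p - q) -> reducible q -> reducible p.
Proof.
move=> Ipq [l [c cI]]; exists l, c.
rewrite -[p](subrK q) mulrDr -addrA; apply: idealD => //; exact: idealM.
Qed.

Lemma reducible_a p : reducible (yin a * p) -> reducible p.
Proof. by move=> [l [c cI]]; exists l.+1, c; rewrite exprSr -mulrA. Qed.

(** Induction along [Tx]. A monomial outside the box has some exponent at least [max_power], so it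
    is divisible by the leading monomial of every pure power of that [x_i]. Since [a] is a multiple
    of the leading coefficient of one such [g], subtracting a multiple of [g] turns [a] times the
    monomial into smaller monomials, collected in [S]. *)
Lemma reducible_xm b : reducible (xm b).
Proof.
have [tT aT rT cT wT] := Tx_ok.
elim/(well_founded_ind wT): b => b IH.
have [/Hms.2[j ->]|nb] := pselect (forall i, (b i < max_power Tx G i)%N).
  exists 0%N, (fun i => (i == j)%:R).
  rewrite expr0 mul1r (bigD1 j) //= eqxx rmorph1 mul1r big1 ?addr0 ?subrr.
    exact: ideal0.
  by move=> i /negbTE ->; rewrite rmorph0 mul0r.
have [i bi] : exists i, (max_power Tx G i <= b i)%N.
  apply: contrapT => nex; apply: nb => i; rewrite ltnNge; apply/negP => h.
  by apply: nex; exists i.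
have [g [w [gp aE]]] := Ha i.
have [Ig gE] : I g /\ lead_mon_x Tx g = xdeg i (lead_mon_x Tx g i).
  by move: gp; rewrite mem_filter => /andP[/and3P[_ _ /eqP] ? /HG.1].
set d := lead_mon_x Tx g in gE aE *.
have db : (d <= b)%MM.
  apply/mnm_lepP => j; rewrite gE mulmnE mnm1E; case: eqP => // <-.
  rewrite mul1n; apply: leq_trans bi.
  exact: (leq_bigmax_seq (F := fun g => lead_mon_x Tx g i) g gp).
apply: reducible_a.
pose S := \sum_(a <- msupp g | mpart xv a != d) g@_a *: 'X_[a].
apply: (@reducible_mod _ (- yin w * xm (b - d)%MM * S)); last first.
  rewrite mulr_sumr big_seq_cond; apply: reducible_sum => e /andP[eg ne].
  have -> : - yin w * xm (b - d)%MM * (g@_e *: 'X_[e]) =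
      yin (- w * (g@_e *: 'X_[mpart yv e])) * xm (b - d + mpart xv e)%MM.
    rewrite rmorphM rmorphN /= yinZ (mpolyX_xy e) mpushD mpolyXD.
    by rewrite -!mul_mpolyC; ring.
  apply: reducibleM; apply: IH; rewrite -{2 4}(submK db).
  rewrite [(_ + mpart xv e)%MM]addmC [(_ + d)%MM]addmC; apply/andP; split.
    apply: contra ne => /eqP /(congr1 (fun u => u - (b - d))%MM).
    by rewrite !addmK => ->.
  by apply: cT; apply: max_mon_ge => //; apply: map_f.
have -> : yin a * xm b - - yin w * xm (b - d)%MM * S = yin w * xm (b - d)%MM * g.
  have gS : g = yin (xcoef d g) * xm d + S 
    by rewrite yin_xcoef {1}[g]mpolyE (bigID (fun e => mpart xv e == d)).
  by rewrite [in RHS]gS -{1}(submK db) mpushD mpolyXD aE rmorphM; ring.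
exact: idealM.
Qed.

Lemma reducible_all p : reducible p.
Proof.
rewrite [p]mpolyE; apply: reducible_sum => b _.
rewrite mpolyX_xy -mul_mpolyC mulrA.
have -> : (p@_b)%:MP * yin 'X_[mpart yv b] = yin (p@_b *: 'X_[mpart yv b]).
  by rewrite yinZ mul_mpolyC.
exact/reducibleM/reducible_xm.
Qed.

End Generation.
End GroebnerX.
End XPolynomials.

(** * Relations between the monomials generating B' *)

Lemma msupp_sumP (R : nzRingType) n (J : finType) (F : J -> {mpoly R[n]}) a :
  a \in msupp (\sum_j F j) -> exists j, a \in msupp (F j).
Proof.
rewrite mcoeff_msupp raddf_sum => nz; apply: contrapT => nj.
case/eqP: nz; apply: big1 => j _; apply: memN_msupp_eq0.
by apply/negP => aj; apply: nj; exists j.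
Qed.

Lemma msupp_rename (k : fieldType) q N (f : 'I_q -> 'I_N) (p : {mpoly k[q]}) a :
  a \in msupp (rename f p) -> exists2 b, b \in msupp p & a = mpush f b.
Proof.
rewrite renameE => /msupp_sum_le; rewrite filter_predT => /flatten_mapP[b bp].
by move=> /msuppZ_le; rewrite msuppX inE => /eqP ->; exists b.
Qed.

Lemma mcoeff_rename (k : fieldType) q N (f : 'I_q -> 'I_N) (p : {mpoly k[q]}) b :
  injective f -> (rename f p)@_(mpush f b) = p@_b.
Proof.
move=> fI; rewrite renameE {3}[p]mpolyE !raddf_sum; apply: eq_bigr => a _.
by rewrite /= !mcoeffZ !mcoeffX (can_eq (mpushK fI)).
Qed.

Section ModuleRelations.
Variables (k : fieldType) (m n r : nat).
Local Notation xv := (@xvar m n).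
Local Notation yin := (@yincl k m n).
Local Notation xm a := ('X_[mpush xv a] : {mpoly k[m + n]}).
Local Notation Nv := (m + n + (1 + r))%N.
Local Notation Y := (@xyvar m n r \o @yvar m n).
Local Notation U := (@uvar m n r).
Local Notation XT := (@xtauvar m n r).
Local Notation TU := (@tauuvar m n r).

Lemma xyvar_inj : injective (@xyvar m n r). Proof. exact: lshift_inj. Qed.
Lemma Y_inj : injective Y. Proof. by move=> i j /xyvar_inj/yv_inj. Qed.
Lemma U_inj : injective U. Proof. by move=> i j /rshift_inj/rshift_inj. Qed.

Lemma big_varP (j : 'I_Nv) :
  [\/ exists i, j = Y i, exists i, j = U i | exists i, j = XT i].
Proof.
case: (split_ordP j) => i ->; case: (split_ordP i) => l ->.
- by constructor 1; exists l.
- constructor 3; exists (lshift 1 l).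
  by rewrite /xtauvar (unsplitK (inl l)).
- constructor 3; exists (rshift n ord0).
  by rewrite /xtauvar (unsplitK (inr ord0)) /tauvar [l]ord1.
- by constructor 2; exists l.
Qed.

Lemma U_neq_Y i j : U i != Y j. Proof. by rewrite eq_rlshift. Qed.

Lemma XT_neq_Y i j : XT i != Y j.
Proof.
rewrite /xtauvar; case: split => l; last by rewrite eq_rlshift.
by rewrite (inj_eq xyvar_inj) xv_yv.
Qed.

Lemma XT_neq_U i j : XT i != U j.
Proof.
rewrite /xtauvar; case: split => l; first by rewrite eq_lrshift.
by rewrite (inj_eq (@rshift_inj _ _)) eq_lrshift.
Qed.

Lemma mpart_yu b j : mpart Y (mpush Y b + U_(U j))%MM = b.
Proof.
rewrite mpartD (mpushK Y_inj) -mpushU mpush_out ?addm0 // => i l.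
by rewrite eq_sym U_neq_Y.
Qed.

Lemma mpart_uu b j : mpart U (mpush Y b + U_(U j))%MM = U_(j)%MM.
Proof.
rewrite mpartD (mpush_out (f := Y)) ?add0m => [|i l]; last exact: U_neq_Y.
by rewrite -mpushU (mpushK U_inj).
Qed.

Lemma mpart_xtu b j : mpart XT (mpush Y b + U_(U j))%MM = 0%MM.
Proof.
rewrite mpartD (mpush_out (f := Y)) ?add0m => [|i l]; last exact: XT_neq_Y.
by rewrite -mpushU mpush_out // => i l; apply: XT_neq_U.
Qed.

Lemma big_ext (a b : 'X_{1..Nv}) : mpart XT a = mpart XT b ->
  mpart U a = mpart U b -> mpart Y a = mpart Y b -> a = b.
Proof.
move=> /mnmP ex /mnmP eu /mnmP ey; apply/mnmP => j.
by case: (big_varP j) => -[i ->]; [have := ey i | have := eu i | have := ex i];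
  rewrite !mnmE.
Qed.

Lemma big_order_ok T1 T2 T3 : monomial_order T1 -> monomial_order T2 ->
  monomial_order T3 -> monomial_order (xtau_u_y_order T1 T2 T3 : rel 'X_{1..Nv}).
Proof.
move=> T1_ok T2_ok T3_ok; apply: preorder_monomial.
  apply: (block_preorder _ T1_ok); apply: (block_preorder _ T2_ok).
  exact: (part_preorder _ T3_ok).
move=> a b /andP[Tab Tba].
have [ex {}Tab {}Tba] := block_anti T1_ok Tab Tba.
have [eu {}Tab {}Tba] := block_anti T2_ok Tab Tba.
apply: big_ext => //; have [_ aT _ _ _] := T3_ok; apply: aT.
by apply/andP.
Qed.

Variables (I : ideal {mpoly k[m + n]}) (ms : 'I_r -> 'X_{1..n}).

Definition ulin (c : 'I_r -> {mpoly k[m]}) : {mpoly k[Nv]} :=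
  \sum_j rename Y (c j) * 'X_(U j).

Lemma msupp_ulin c a : a \in msupp (ulin c) ->
  exists b j, a = (mpush Y b + U_(U j))%MM.
Proof.
move=> /msupp_sumP[j]; rewrite mulrC => /msupp_mulX[d /msupp_rename[b _ ->] ->].
by exists b, j; rewrite addmC.
Qed.

Lemma mcoeff_ulin c b j : (ulin c)@_(mpush Y b + U_(U j))%MM = (c j)@_b.
Proof.
rewrite raddf_sum (bigD1 j) //= [X in X + _](_ : _ = (c j)@_b); last first.
  by rewrite addmC mcoeffMX mcoeff_rename //; apply: Y_inj.
rewrite big1 ?addr0 // => i nij; apply: memN_msupp_eq0; apply/negP.
rewrite mulrC => /msupp_mulX[d /msupp_rename[b' _ ->]].
move=> /(congr1 (mpart U)); rewrite mpart_uu addmC mpart_uu => /mnmP/(_ j).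
by rewrite !mnm1E eqxx (negbTE nij).
Qed.

Lemma ulinB c d : ulin (fun j => c j - d j) = ulin c - ulin d.
Proof.
rewrite /ulin -sumrB; apply: eq_bigr => j _.
by rewrite rmorphB mulrBl.
Qed.

Lemma ulinM p c : ulin (fun j => p * c j) = rename Y p * ulin c.
Proof.
rewrite /ulin mulr_sumr; apply: eq_bigr => j _.
by rewrite rmorphM mulrA.
Qed.

Lemma ulin1 p j : ulin (fun i => p *+ (i == j)) = rename Y p * 'X_(U j).
Proof.
rewrite /ulin (bigD1 j) //= eqxx big1 ?addr0 // => i /negbTE ->.
by rewrite mulr0n rmorph0 mul0r.
Qed.

(** The substitution [tau = 1], [u_j = m_j] fixes [k[y, x]] and sends the module ideal into [I]; it
    converts linear forms in [u] back into relations. *)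
Definition to_xy : {mpoly k[Nv]} -> {mpoly k[m + n]} :=
  comp_mpoly [tuple match split j with
    | inl i => 'X_i
    | inr i => match split i with inl _ => 1 | inr l => xm (ms l) end
    end | j < Nv].
HB.instance Definition _ := GRing.RMorphism.on to_xy.

Lemma to_xyX j : to_xy 'X_j = match split j with
    | inl i => 'X_i
    | inr i => match split i with inl _ => 1 | inr l => xm (ms l) end
    end.
Proof. by rewrite /to_xy comp_mpolyXU -tnth_nth tnth_mktuple. Qed.

Lemma to_xy_tau : to_xy 'X_(tauvar m n r) = 1.
Proof. by rewrite to_xyX (unsplitK (inr _)) (unsplitK (inl _)). Qed.

Lemma to_xy_u j : to_xy 'X_(U j) = xm (ms j).
Proof. by rewrite to_xyX !(unsplitK (inr _)). Qed.

Lemma to_xy_rename p : to_xy (rename (@xyvar m n r) p) = p.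
Proof.
rewrite /to_xy comp_rename -[RHS]comp_mpoly_id; congr comp_mpoly.
by apply: eq_from_tnth => i; rewrite !tnth_mktuple (unsplitK (inl _)).
Qed.

Lemma to_xy_y p : to_xy (rename Y p) = yin p.
Proof. by rewrite -rename_comp to_xy_rename. Qed.

Lemma to_xy_ideal f : module_ideal I ms f -> I (to_xy f).
Proof.
apply: (@ideal_gen_sub _ (preim_ideal to_xy I)) => {}f /=.
case=> [[p Ip ->]|[j ->]]; first by rewrite to_xy_rename.
rewrite rmorphB rmorphM /= to_xy_tau to_xy_u -rename_comp to_xy_rename renameX.
by rewrite mul1r subrr; apply: ideal0.
Qed.

Lemma to_xy_ulin c : to_xy (ulin c) = \sum_j yin (c j) * xm (ms j).
Proof.
rewrite rmorph_sum; apply: eq_bigr => j _.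
by rewrite rmorphM /= to_xy_u to_xy_y.
Qed.

Definition module_idealL : ideal {mpoly k[Nv]} :=
  gen_ideal (fun f => (exists2 p, I p & f = rename (@xyvar m n r) p) \/
    exists j, f = 'X_(U j) -
                  'X_(tauvar m n r) * rename (@xyvar m n r \o xv) 'X_[ms j]).

(** Modulo the module ideal each [u_j] equals [tau * m_j], so the linear form becomes [tau] times an
    element of [I]. *)
Lemma ulin_mem c :
  I (\sum_j yin (c j) * xm (ms j)) -> module_idealL (ulin c).
Proof.
move=> Ic.
pose v j : {mpoly k[Nv]} :=
  'X_(tauvar m n r) * rename (@xyvar m n r \o xv) 'X_[ms j].
have -> : ulin c = \sum_j rename Y (c j) * ('X_(U j) - v j) +
    'X_(tauvar m n r) * rename (@xyvar m n r) (\sum_j yin (c j) * xm (ms j)).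
  rewrite rmorph_sum mulr_sumr -big_split; apply: eq_bigr => j _.
  rewrite /v -(rename_comp xv (@xyvar m n r)) renameX rmorphM /= rename_comp.
  by rewrite mulrBr mulrCA subrK.
apply: idealD.
  apply: ideal_sum => j _; apply: idealM; apply: ideal_gen_incl; right.
  by exists j.
apply: idealM; apply: ideal_gen_incl; left.
by exists (\sum_j yin (c j) * xm (ms j)).
Qed.

Variables (T1 : rel 'X_{1..n + 1}) (T2 : rel 'X_{1..r}) (T3 : rel 'X_{1..m}).
Hypotheses (T1_ok : monomial_order T1) (T2_ok : monomial_order T2).
Hypothesis T3_ok : monomial_order T3.
Variables (H : seq {mpoly k[Nv]}) (s : nat) (N : 'M[{mpoly k[m]}]_(r, s)).
Hypothesis HH : groebner (xtau_u_y_order T1 T2 T3) (module_ideal I ms) H.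
Hypothesis Hhom : forall p, p \in H -> homogeneous_in TU p.
Hypothesis HN : is_relation_matrix H N.

Lemma relation_matrix_sound q : I (\sum_j yin (N j q) * xm (ms j)).
Proof.
have [h [_ hP hE]] := HN; rewrite -to_xy_ulin; apply: to_xy_ideal.
rewrite /ulin -hE; apply: HH.1.
by have [] := proj1 (hP (h q)) (ex_intro _ q erefl).
Qed.

Lemma mdeg_tauu (a : 'X_{1..Nv}) : mpart XT a = 0%MM ->
  mdeg (mpart TU a) = mdeg (mpart U a).
Proof.
move=> /mnmP/(_ (rshift n ord0)); rewrite mnmE mnm0E /xtauvar (unsplitK (inr _)) => a0.
rewrite !mdegE big_split_ord /= big_ord1 mnmE a0 add0n.
by apply: eq_bigr => i _; rewrite !mnmE.
Qed.

(** The linear form of a relation is reduced by [H]. Each reducer lies in [k[y, u]] and is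
    homogeneous of degree 0 or 1 in [u]. Degree 0 means an element of [J], degree 1 a column of [N];
    the result therefore holds modulo [J]. *)
Lemma relation_matrix_complete c : I (\sum_j yin (c j) * xm (ms j)) ->
  exists v : 'I_s -> {mpoly k[m]},
    forall j, I (yin (c j - \sum_q N j q * v q)).
Proof.
move=> /ulin_mem; move: {2}(ulin c) (erefl (ulin c)) => f fE; rewrite fE => Lf.
have T_ok := big_order_ok T1_ok T2_ok T3_ok.
move: f Lf c fE; apply: (groebner_ind (I := module_idealL) T_ok HH).
  move=> c c0; exists (fun=> 0) => j; rewrite big1 ?subr0 => [|q _]; last exact: mulr0.
  suff -> : c j = 0 by rewrite rmorph0; apply: ideal0.
  by apply/mpolyP => b; rewrite -mcoeff_ulin c0 !mcoeff0.
move=> f h' c0 x Lf nf h'H Lh' nh' lf IH c fE.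
have [b [j lE]] : exists b j, lead_mon (xtau_u_y_order T1 T2 T3) f =
    (mpush Y b + U_(U j))%MM.
  by apply: (@msupp_ulin c); rewrite fE; apply: (lead_mon_mem T_ok).
rewrite lE in lf; set lh := lead_mon _ h' in lf.
have lh_supp : lh \in msupp h' by apply: (lead_mon_mem T_ok).
have [c0x lhx] : mpart XT c0 = 0%MM /\ mpart XT lh = 0%MM.
  have := congr1 (mpart XT) lf; rewrite mpart_xtu mpartD => /esym/eqP.
  by rewrite mnmD_eq0 => /andP[/eqP ? /eqP].
(* The block order puts [x] and [tau] first, so their absence from the leading monomial excludes
   them everywhere. Homogeneity in [tau] and [u] is then homogeneity in [u]. *)
have h'x a : a \in msupp h' -> mpart XT a = 0%MM.
  move=> /(lead_mon_ge T_ok); rewrite -/lh /xtau_u_y_order /block_order lhx.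
  by case: eqP => // _; rewrite /part_order lhx; apply: (order_le0 T1_ok).
have h'u a : a \in msupp h' -> mdeg (mpart U a) = mdeg (mpart U lh).
  have [d dE] := Hhom h'H => ah.
  by rewrite -!mdeg_tauu ?h'x // !dE.
have lfu : U_(j)%MM = (mpart U c0 + mpart U lh)%MM by rewrite -mpartD -lf mpart_uu.
(* Degree 0: the reducer belongs to [J], and only the coefficient of [u_j] changes. *)
have [u0|u0] := eqVneq (mdeg (mpart U lh)) 0%N.
  have h'E : h' = rename Y (\sum_(a <- msupp h') h'@_a *: 'X_[mpart Y a]).
    rewrite {1}[h']mpolyE rmorph_sum big_seq [RHS]big_seq; apply: eq_bigr => a ah.
    rewrite /= renameZ renameX; congr (_ *: 'X_[_]); apply: big_ext.
    - by rewrite h'x // mpush_out // => i l; apply: XT_neq_Y.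
    - rewrite mpush_out => [|i l]; last exact: U_neq_Y.
      by apply/eqP; rewrite -mdeg_eq0 h'u // u0.
    - by rewrite (mpushK Y_inj).
  set p := \sum_(a <- msupp h') _ in h'E.
  have Ip : I (yin p) by rewrite -to_xy_y -h'E; apply: to_xy_ideal.
  have c0E : c0 = (mpush Y (mpart Y c0) + U_(U j))%MM.
    apply: big_ext; rewrite ?mpart_xtu ?mpart_uu ?mpart_yu // lfu.
    by move/eqP: u0; rewrite mdeg_eq0 => /eqP ->; rewrite addm0.
  pose d := x *: 'X_[mpart Y c0] * p.
  have [|v vI] := IH (fun i => c i - d *+ (i == j)).
    rewrite ulinB ulin1 fE; congr (_ - _).
    rewrite c0E mpolyXD -(renameX k Y) h'E /d rmorphM /= renameZ.
    by rewrite -!mul_mpolyC -!mulrA; congr (_ * (_ * _)); rewrite mulrC.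
  exists v => i; have := vI i.
  have -> : yin (c i - \sum_q N i q * v q) =
    yin (c i - d *+ (i == j) - \sum_q N i q * v q) + yin (d *+ (i == j)).
    by rewrite -rmorphD; congr yincl; ring.
  move=> h; apply: idealD => //; rewrite rmorphMn; case: (i == j) => /=.
    by rewrite mulr1n /d rmorphM; apply: idealM.
  by rewrite mulr0n; apply: ideal0.
(* Degree 1: the reducer is some [h q], and its cofactor is a monomial in [y], which is added to the
   coefficient of column [q]. *)
have [u1 uc0] : mdeg (mpart U lh) = 1%N /\ mpart U c0 = 0%MM.
  have := congr1 mdeg lfu; rewrite mdeg1 mdegD => /esym e.
  move: e u0; case: (mdeg (mpart U lh)) => // e; rewrite addnS => -[/eqP].
  by rewrite addn_eq0 mdeg_eq0 => /andP[/eqP -> /eqP ->].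
have [h [_ hP hE]] := HN.
have [q hq] : exists q, h' = h q.
  apply/hP; split=> //.
    apply/allP => a ah; apply/forallP => i; apply/implyP => ai.
    case: (big_varP i) => -[l lE']; rewrite /is_yu.
    - by apply/orP; left; rewrite lE' codom_f.
    - by apply/orP; right; rewrite lE' codom_f.
    - by move/mnmP: (h'x _ ah) => /(_ l); rewrite mnmE mnm0E -lE' => e; rewrite e in ai.
  apply/eqP; rewrite eqn_leq; apply/andP; split.
    by apply/bigmax_leqP_seq => a ah _; rewrite h'u // u1.
  apply: (@leq_trans (mdeg (mpart U lh))); first by rewrite u1.
  exact: (leq_bigmax_seq (F := fun a => mdeg (mpart U a)) lh).
have c0E : c0 = mpush Y (mpart Y c0).
  apply: big_ext.
  - by rewrite c0x mpush_out // => i l; apply: XT_neq_Y.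
  - by rewrite uc0 mpush_out // => i l; apply: U_neq_Y.
  - by rewrite (mpushK Y_inj).
pose d : {mpoly k[m]} := x *: 'X_[mpart Y c0].
have [|v vI] := IH (fun i => c i - d * N i q).
  rewrite ulinB ulinM fE; congr (_ - _).
  by rewrite hq hE [in RHS]c0E /d renameZ renameX -scalerAl.
exists (fun q' => v q' + d *+ (q' == q)) => i; have := vI i.
congr (ideal_mem I (@yincl k m n _)); rewrite -addrA -opprD; congr (_ - _).
under [RHS]eq_bigr do rewrite mulrDr.
rewrite big_split /= addrC; congr (_ + _).
rewrite (bigD1 q) //= eqxx mulr1n mulrC big1 ?addr0 // => q' /negbTE ->.
by rewrite mulr0n mulr0.
Qed.

End ModuleRelations.

(** * Derivations and the Jacobian ideal *)

Section Derivations.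
Variables (k : fieldType) (m n : nat).
Local Notation S := {mpoly k[m + n]}.
Local Notation xv := (@xvar m n).
Local Notation yv := (@yvar m n).
Local Notation yin := (@yincl k m n).
Local Notation xm a := ('X_[mpush xv a] : S).

Lemma mderiv_yin c i : (yin c)^`M(xv i) = 0.
Proof.
rewrite /yincl renameE raddf_sum big1 // => a _.
rewrite /= mderivZ mderivX -[RHS](scaler0 _ c@_a); congr (_ *: _).
have := mpart_xy_push n a => /mnmP/(_ i); rewrite mnmE mnm0E => ->.
by rewrite scale0r.
Qed.

Lemma mderiv_xvar i j : ('X_(xv i) : S)^`M(xv j) = (i == j)%:R.
Proof.
rewrite mderivX mnm1E (inj_eq (@xv_inj m n)); case: eqP => [->|_].
  rewrite scale1r (_ : (_ - _)%MM = 0%MM) ?mpolyX0 //.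
  by apply/mnmP => l; rewrite mnmBE subnn mnm0E.
by rewrite scale0r.
Qed.

(** By the Leibniz rule a derivation is determined on [k[y]] and the [x_i]. The form with zero is
    applied to a difference of derivations. *)
Lemma derivation_ext (R : comPzRingType) (M : lmodType R)
    (rho : {rmorphism S -> R}) (D : S -> M) :
    {morph D : p q / p + q} ->
    (forall p q, D (p * q) = rho p *: D q + rho q *: D p) ->
    (forall c, D (yin c) = 0) -> (forall i, D 'X_(xv i) = 0) ->
  forall p, D p = 0.
Proof.
move=> DD DM Dy Dx.
have D1 : D 1 = 0 by rewrite -(rmorph1 yin); apply: (Dy).
have D0M p q : D p = 0 -> D q = 0 -> D (p * q) = 0.
  by move=> ep eq; rewrite DM ep eq !scaler0 addr0.
have DX a : D (xm a) = 0.
  rewrite -(renameX k) mpolyXE_id rmorph_prod.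
  elim/big_rec: _ => [//|i p _ Dp]; apply: (D0M) => //.
  rewrite rmorphXn /= renameX mpushU; elim: (a i) => [//|j IH].
  by rewrite exprS; apply: (D0M).
elim/mpolyind => [|c a p _ _ IH]; first by rewrite -(rmorph0 yin); apply: (Dy).
rewrite DD IH addr0 mpolyX_xy scalerAl -yinZ; apply: (D0M) => //.
Qed.

(** [A] and [B] are abstract, since unification would otherwise unfold the
    quotients of polynomial rings. *)
Variables (I : ideal S) (t : nat) (g : 'I_t -> S).
Hypothesis Hg : forall f, I f <-> ideal_gen (fun p => exists j, p = g j) f.
Variables (A B : comPzRingType) (F : {rmorphism A -> B}).
Variables (pA : {rmorphism {mpoly k[m]} -> A}) (pB : {rmorphism S -> B}).
Hypothesis FpA : forall c, F (pA c) = pB (yin c).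
Hypothesis pB_surj : forall z, exists p, pB p = z.
Hypothesis pA_surj : forall z, exists c, pA c = z.
Hypothesis pB_eq0 : forall p, pB p = 0 <-> I p.
Variable a : {mpoly k[m]}.
Local Notation pa := (pA a).
Local Notation Ba := (loc (F pa)).

Definition rho : S -> Ba := to_loc (F pa) \o pB.
HB.instance Definition _ := GRing.RMorphism.on rho.

Lemma rho_yin c : rho (yin c) = loc_map F pa (to_loc pa (pA c)).
Proof. by rewrite loc_map_to_loc /rho /= -FpA. Qed.

Lemma rho_a : rho (yin a) = to_loc (F pa) (F pa).
Proof. by rewrite /rho /= -FpA. Qed.

Lemma rho_eq0 p : rho p = 0 <-> exists l, I (yin a ^+ l * p).
Proof.
rewrite /rho /= to_loc_eq0; split=> -[l h]; exists l.
  by apply/pB_eq0; rewrite rmorphM rmorphXn /= -FpA.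
by move/pB_eq0: h; rewrite rmorphM rmorphXn /= -FpA.
Qed.

Lemma rho_clear z : exists l p, rho (yin a) ^+ l * z = rho p.
Proof.
have [l [x e]] := loc_clear z; have [p pE] := pB_surj x; exists l, p.
by rewrite rho_a e -pE.
Qed.

Definition rho_inv l : Ba := loc_inv (F pa) l.

Lemma rho_invK l : rho_inv l * rho (yin a) ^+ l = 1.
Proof. by rewrite rho_a loc_invK. Qed.

Lemma rho_invKx l x : rho_inv l * (rho (yin a) ^+ l * x) = x.
Proof. by rewrite mulrA rho_invK mul1r. Qed.

Lemma rho_invE l z p : rho (yin a) ^+ l * z = rho p -> z = rho_inv l * rho p.
Proof. by move=> <-; rewrite rho_invKx. Qed.

Lemma rho_I p : I p -> rho p = 0.
Proof. by move=> Ip; apply/rho_eq0; exists 0%N; rewrite expr0 mul1r. Qed.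

Lemma I_g j : I (g j).
Proof. by apply/Hg/ideal_gen_incl; exists j. Qed.

(** The chain rule: both sides are derivations in [p], zero on [k[y]] and equal on the [x_i]. *)
Lemma derivation_chain (M : lmodType Ba) (D : Ba -> M) p :
    is_derivation (loc_map F pa) D ->
  D (rho p) = \sum_i rho p^`M(xv i) *: D (rho 'X_(xv i)).
Proof.
move=> [DD DM DA]; apply/eqP; rewrite -subr_eq0; apply/eqP.
move: p; apply: (@derivation_ext _ _ rho) => [p q|p q|c|i].
- under eq_bigr => i _ do rewrite mderivD rmorphD scalerDl.
  by rewrite big_split rmorphD DD opprD addrACA.
- rewrite rmorphM DM !scalerBr addrACA; congr (_ + _); rewrite -opprD; congr (- _).
  rewrite !scaler_sumr -big_split; apply: eq_bigr => i _.
  by rewrite mderivM rmorphD !rmorphM scalerDl !scalerA addrC [rho q * _]mulrC.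
- rewrite rho_yin DA big1 ?subrr // => i _.
  by rewrite mderiv_yin rmorph0 scale0r.
- rewrite (bigD1 i) //= mderiv_xvar eqxx rmorph1 scale1r big1 ?addr0 ?subrr //.
  by move=> l /negbTE nl; rewrite mderiv_xvar eq_sym nl rmorph0 scale0r.
Qed.

(** Applying a derivation to the generators [g j] gives linear equations for the [D x_i]; by
    Cramer's rule every maximal minor kills them. As [c] is a unit in the localization, all
    derivations vanish and the zero module is the module of differentials. *)
Lemma jac_unramified c w : jac_ideal I g (yin c) -> a = w * c ->
  unramified (loc_map F pa).
Proof.
move=> Jc aE.
have D0 (M : lmodType Ba) (D : Ba -> M) :
    is_derivation (loc_map F pa) D -> forall z, D z = 0.
  move=> Dd; have [DD DM DA] := Dd.
  have D0 : D 0 = 0 by rewrite -(rmorph0 (loc_map F pa)); apply: (DA).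
  pose K := annihilator rho (fun i => D (rho 'X_(xv i))).
  have Kc : K (yin c).
    apply: ideal_gen_sub Jc => p [[f [f' [fh _ ->]]]|/rho_I p0]; last first.
      by move=> i /=; rewrite p0 scale0r.
    have fI : injective f.
      by move=> u v e; case: (ltngtP u v) => [||/val_inj//] /fh; rewrite e ltnn.
    set Q := mxsub _ _ _.
    have col0 j : \sum_i rho (Q i j) *: D (rho 'X_(xv (f i))) = 0.
      transitivity (D (rho (g (f' j)))); last by rewrite (rho_I (I_g _)).
      rewrite (derivation_chain _ Dd) [RHS](reindex_inj fI).
      by apply: eq_bigr => i _; rewrite !mxE.
    (* A minor of order [n] uses all [n] rows, so every [x_i] is reached. *)
    have [f1 f1K fK] := injF_bij fI.
    move=> i; rewrite -(fK i); set l := f1 i.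
    transitivity (\sum_i (\sum_j rho (Q i j * \adj Q j l)) *: D (rho 'X_(xv (f i)))).
      have AA i' : \sum_j rho (Q i' j * \adj Q j l) = rho (\det Q) *+ (i' == l).
        rewrite -rmorph_sum -rmorphMn; congr rho.
        by have /matrixP/(_ i' l) := mul_mx_adj Q; rewrite !mxE.
      rewrite (bigD1 l) //= AA eqxx big1 ?addr0 // => i' /negbTE nl.
      by rewrite AA nl scale0r.
    under eq_bigr => i' _ do rewrite scaler_suml.
    rewrite exchange_big big1 // => j _.
    transitivity (rho (\adj Q j l) *: (\sum_i rho (Q i j) *: D (rho 'X_(xv (f i))))).
      rewrite scaler_sumr; apply: eq_bigr => i' _.
      by rewrite rmorphM scalerA mulrC.
    by rewrite col0 scaler0.
  have DX i : D (rho 'X_(xv i)) = 0.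
    rewrite -[LHS]scale1r -(rho_invK 1) expr1 [X in yin X]aE !rmorphM.
    by rewrite mulrA -scalerA Kc scaler0.
  have Drho p : D (rho p) = 0.
    by rewrite (derivation_chain _ Dd) big1 // => i _; rewrite DX scaler0.
  move=> z; have [l [p zE]] := rho_clear z.
  have := Drho p; rewrite -zE DM -rmorphXn -rmorphXn Drho scaler0 addr0 => e.
  by rewrite -[LHS]scale1r -(rho_invK l) -scalerA -rmorphXn -rmorphXn e scaler0.
(* Row vectors of length 0 provide the zero module. *)
exists 'rV[Ba]_0, (fun=> 0); split; last by move=> w'; apply/matrixP => ? [].
split=> [|M D Dd].
  by split=> // [x y|x y]; rewrite ?scaler0 addr0.
exists (fun=> 0); split.
  split=> [b x y|z]; first by rewrite scaler0 addr0.
  by rewrite (D0 M D Dd).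
move=> h [hl hD]; apply/funext => w'.
rewrite (_ : w' = 0); last by apply/matrixP => ? [].
by have := hD 0; rewrite (D0 M D Dd).
Qed.

Definition grad (p : S) : 'rV[Ba]_n := \row_i rho p^`M(xv i).

Lemma gradD p q : grad (p + q) = grad p + grad q.
Proof. by apply/rowP => i; rewrite !mxE mderivD rmorphD. Qed.

Lemma gradB p q : grad (p - q) = grad p - grad q.
Proof. by apply/rowP => i; rewrite !mxE mderivB rmorphB. Qed.

Lemma gradM p q : grad (p * q) = rho p *: grad q + rho q *: grad p.
Proof.
by apply/rowP => i; rewrite !mxE mderivM rmorphD !rmorphM addrC [rho q * _]mulrC.
Qed.

Lemma grad_yin c : grad (yin c) = 0.
Proof. by apply/rowP => i; rewrite !mxE mderiv_yin rmorph0. Qed.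

Lemma grad_yinM c p : grad (yin c * p) = rho (yin c) *: grad p.
Proof. by rewrite gradM grad_yin scaler0 addr0. Qed.

(** The row span of the transposed Jacobian matrix; the quotient by it is the usual presentation of
    the differentials of the localized algebra. *)
Definition grad_span : submodule 'rV[Ba]_n.
Proof.
refine (@Submodule _ _ (fun u => exists w : 'rV_t,
  u = w *m map_mx rho (jacobian g)^T) _ _ _).
- by exists 0; rewrite mul0mx.
- by move=> _ _ [w ->] [w' ->]; exists (w + w'); rewrite mulmxDl.
- by move=> b _ [w ->]; exists (b *: w); rewrite scalemxAl.
Defined.

Lemma grad_I p : I p -> grad_span (grad p).
Proof.
move=> /Hg[s [sg ->]].
rewrite (big_morph grad gradD (_ : grad 0 = 0)); last first.
  by apply/rowP => i; rewrite !mxE mderiv0 rmorph0.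
rewrite big_seq; elim/big_ind: _ => [|x y|q qs]; first exact: submod0.
  exact: submodD.
have [j ->] := sg _ qs; rewrite gradM (rho_I (I_g j)) scale0r addr0.
apply: submodZ; exists (delta_mx 0 j); rewrite -rowE.
by apply/rowP => i; rewrite !mxE.
Qed.

Lemma grad_span_unit l u : grad_span (rho (yin a) ^+ l *: u) -> grad_span u.
Proof.
by move=> /(submodZ (rho_inv l)); rewrite scalerA rho_invK scale1r.
Qed.

(** The derivative of a fraction is the gradient of its numerator over the same denominator, since
    [a] lies in [k[y]] and is a constant. Two numerators of one fraction agree modulo [I] up to
    powers of [a], and gradients of elements of [I] lie in the span. *)
Lemma grad_welldef z l l' p p' :
  rho (yin a) ^+ l * z = rho p -> rho (yin a) ^+ l' * z = rho p' ->
  quotm_pi grad_span (rho_inv l *: grad p) =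
  quotm_pi grad_span (rho_inv l' *: grad p').
Proof.
move=> zp zp'; apply/quotm_pi_eq.
have /rho_eq0[q] : rho (yin (a ^+ l') * p - yin (a ^+ l) * p') = 0.
  by rewrite rmorphB !rmorphM !rmorphXn /= -zp -zp' mulrCA subrr.
rewrite -rmorphXn => /grad_I; rewrite grad_yinM gradB !grad_yinM !rmorphXn /=.
move=> /grad_span_unit h; apply: (@grad_span_unit (l + l')).
have e1 : rho (yin a) ^+ (l + l') * rho_inv l = rho (yin a) ^+ l'.
  by rewrite exprD mulrC mulrA rho_invK mul1r.
have e2 : rho (yin a) ^+ (l + l') * rho_inv l' = rho (yin a) ^+ l.
  by rewrite exprD -mulrA [_ * rho_inv l']mulrC rho_invK mulr1.
by rewrite scalerBr !scalerA e1 e2.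
Qed.

Lemma rho_invD l l' : rho_inv (l + l') = rho_inv l * rho_inv l'.
Proof.
symmetry; rewrite -[RHS]mulr1 -(rmorph1 rho); apply: rho_invE.
rewrite rmorph1 exprD mulrACA ![_ ^+ _ * rho_inv _]mulrC.
by rewrite !rho_invK.
Qed.

Lemma rho_inv_shift l l' : rho_inv (l + l') * rho (yin a) ^+ l' = rho_inv l.
Proof. by rewrite rho_invD -mulrA rho_invK mulr1. Qed.

Lemma grad_derivation : exists D : Ba -> quotm grad_span,
  is_derivation (loc_map F pa) D /\ forall p, D (rho p) = quotm_pi _ (grad p).
Proof.
have /choice[lp lpE] : forall z, exists lp : nat * S,
    rho (yin a) ^+ lp.1 * z = rho lp.2.
  by move=> z; have [l [p e]] := rho_clear z; exists (l, p).
pose D z : quotm grad_span :=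
  quotm_pi grad_span (rho_inv (lp z).1 *: grad (lp z).2).
have DE z l p : rho (yin a) ^+ l * z = rho p ->
    D z = quotm_pi grad_span (rho_inv l *: grad p).
  by move=> e; apply: grad_welldef e; apply: lpE.
exists D; split; last first.
  move=> p; rewrite (DE _ 0%N p) ?expr0 ?mul1r //.
  by rewrite -[rho_inv 0]mulr1 -(expr0 (rho (yin a))) rho_invK scale1r.
split=> [x y|x y|b].
- have [l [p ep]] := rho_clear x; have [l' [p' ep']] := rho_clear y.
  rewrite (DE _ _ _ ep) (DE _ _ _ ep').
  rewrite (DE _ (l + l')%N (yin (a ^+ l') * p + yin (a ^+ l) * p')); last first.
    rewrite rmorphD !rmorphM !rmorphXn /= -ep -ep' exprD; ring.
  rewrite -quotm_piD gradD !grad_yinM !rmorphXn /= scalerDr !scalerA.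
  by rewrite rho_inv_shift addnC rho_inv_shift.
- have [l [p ep]] := rho_clear x; have [l' [p' ep']] := rho_clear y.
  rewrite (DE _ _ _ ep) (DE _ _ _ ep') (DE _ (l + l')%N (p * p')); last first.
    by rewrite rmorphM /= -ep -ep' exprD mulrACA.
  rewrite -!quotm_piZ -quotm_piD gradM scalerDr !scalerA.
  rewrite -ep -ep' !mulrA rho_inv_shift addnC rho_inv_shift.
  by rewrite [rho_inv l' * x]mulrC [rho_inv l * y]mulrC.
- have [l [b' e]] := loc_clear b; have [q qE] := pA_surj b'.
  rewrite (DE _ l (yin q)); last first.
    by rewrite (rho_yin q) qE -e rmorphM rmorphXn /= loc_map_to_loc rho_a.
  by rewrite grad_yin scaler0 linear0.
Qed.

(** If the differentials vanish, so does the derivation given by gradients. Hence the unit vectors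
    [grad x_i] lie in the span and the identity is [W] times the transposed Jacobian. Its
    determinant writes [1] as a combination of maximal minors, and clearing denominators gives a
    power of [a]. *)
Lemma unramified_jac : unramified (loc_map F pa) ->
  exists l, jac_ideal I g (yin (a ^+ l)).
Proof.
move=> [Om [d [[dd univ] Om0]]].
have [D [Dd DE]] := grad_derivation.
have [h [[hl hD] _]] := univ _ _ Dd.
have D0 z : D z = 0.
  rewrite hD /= (Om0 (d z)) -[LHS]addr0 -[X in _ + X = _](addrN (h 0)).
  have := hl 1 0 0; rewrite !scale1r addr0 => e; rewrite addrA.
  by rewrite -e subrr.
have /choice[w wE] : forall i, exists w : 'rV[Ba]_t,
    grad 'X_(xv i) = w *m map_mx rho (jacobian g)^T.
  by move=> i; apply/(quotm_pi_eq0 grad_span); rewrite -DE D0.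
pose W := \matrix_(i, j) w i 0 j.
have W1 : 1%:M = W *m map_mx rho (jacobian g)^T.
  apply/row_matrixP => i; rewrite row_mul.
  have -> : row i W = w i by apply/rowP => j; rewrite !mxE.
  rewrite -wE; apply/rowP => j; rewrite !mxE mderiv_xvar.
  by case: (i == j); rewrite ?rmorph1 ?rmorph0.
(* [Q] is membership in the extension of the Jacobian ideal, with denominators cleared; it is closed
   under sums, so the expansion is treated termwise. *)
pose Q z := exists l p, jac_ideal I g p /\ rho (yin a) ^+ l * z = rho p.
have : Q 1.
  rewrite -(det1 _ n) W1 det_mulmx_expand.
  elim/big_ind: _ => [|x y|f _].
  - by exists 0%N, 0; rewrite rmorph0 mulr0; split=> //; apply: ideal_gen0.
  - move=> [l [p [Jp ep]]] [l' [p' [Jp' ep']]].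
    exists (l + l')%N, (yin (a ^+ l') * p + yin (a ^+ l) * p'); split.
      by apply: ideal_genD; apply: ideal_genM.
    rewrite rmorphD !rmorphM !rmorphXn /= -ep -ep' exprD; ring.
  - have [l [q qE]] := rho_clear (\prod_i W i (f i)).
    exists l, (q * \det (rowsub f (jacobian g)^T)); split.
      apply: ideal_genM; rewrite -det_tr trmx_mxsub trmxK.
      apply: (@ideal_gen_sub _ (gen_ideal _)) (det_mxsub_minors _ _ _) => p mp.
      by apply: ideal_gen_incl; left.
    by rewrite rmorphM /= -det_map_mx map_mxsub -qE mulrA.
move=> [l [p [Jp]]]; rewrite mulr1 => e.
have /rho_eq0[l' h'] : rho (yin (a ^+ l) - p) = 0.
  by rewrite rmorphB !rmorphXn /= e subrr.
exists (l' + l)%N.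
have -> : yin (a ^+ (l' + l)) =
    yin a ^+ l' * (yin (a ^+ l) - p) + yin a ^+ l' * p.
  by rewrite exprD rmorphM !rmorphXn /= mulrBr subrK.
apply: ideal_genD; last exact: ideal_genM.
by apply: ideal_gen_incl; right.
Qed.

End Derivations.

(** * The finite étale locus *)

Section LeadingCoefficient.
Variables (k : fieldType) (m n : nat).
Local Notation S := {mpoly k[m + n]}.
Local Notation xv := (@xvar m n).
Local Notation yv := (@yvar m n).
Local Notation yin := (@yincl k m n).
Local Notation xm a := ('X_[mpush xv a] : S).

Lemma msupp_yin_xm u d a : a \in msupp (yin u * xm d) ->
  mpart xv a = d.
Proof.
rewrite mulrC => /msupp_mulX[b /msupp_rename[b' _ ->] ->].
by rewrite mpartD mpart_x_push mpart_xy_push addm0.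
Qed.

Lemma xcoef_yin_xm c u d : xcoef c (yin u * xm d) = u *+ (c == d).
Proof.
apply/mpolyP => b; rewrite mcoeff_xcoef; case: eqP => [->|ncd].
  by rewrite mulrC addmC mcoeffMXD mcoeff_rename //; apply: yv_inj.
rewrite mcoeff0; apply: memN_msupp_eq0; apply/negP => /msupp_yin_xm.
by rewrite mpartD mpart_x_push mpart_xy_push add0m => /ncd.
Qed.

Lemma lead_coef_at_sum (i : 'I_n) d (u : nat -> {mpoly k[m]}) :
  let f := \sum_(j < d.+1) yin (u j) * 'X_(xv i) ^+ j in
  u d != 0 -> lead_coef_at i f = u d /\
    in_vars [pred j | is_y j || (j == xv i)] f.
Proof.
move=> f nz.
have fE : f = \sum_(j < d.+1) yin (u j) * xm (U_(i) *+ j)%MM.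
  apply: eq_bigr => j _; rewrite mpolyXn; congr (_ * 'X_[_]).
  elim: (j : nat) => [|l IH]; first by rewrite !mulm0n mpush0.
  by rewrite !mulmS IH mpushD mpushU.
have xE (j : 'I_d.+1) : xcoef (U_(i) *+ j)%MM f = u j.
  rewrite fE; apply/mpolyP => b; rewrite mcoeff_xcoef raddf_sum (bigD1 j) //=.
  rewrite -mcoeff_xcoef xcoef_yin_xm eqxx big1 ?addr0 // => l nlj.
  rewrite -mcoeff_xcoef xcoef_yin_xm; case: eqP => [e|_]; last by rewrite mcoeff0.
  case/eqP: nlj; apply/val_inj; have /mnmP/(_ i) := e.
  by rewrite !mulmnE mnm1E eqxx !mul1n.
have supp a : a \in msupp f -> exists j : 'I_d.+1, mpart xv a = (U_(i) *+ j)%MM.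
  by rewrite fE => /msupp_sumP[j /msupp_yin_xm ->]; exists j.
have degE : (\max_(a <- msupp f) a (xv i))%N = d.
  apply/eqP; rewrite eqn_leq; apply/andP; split.
    apply/bigmax_leqP_seq => a /supp[j /mnmP/(_ i)] + _.
    by rewrite mnmE mulmnE mnm1E eqxx mul1n => ->; rewrite -ltnS.
  have [|a af /mnmP/(_ i)] := @xcoef_supp k m n (U_(i) *+ (@ord_max d))%MM f.
    by rewrite xE.
  rewrite mnmE mulmnE mnm1E eqxx mul1n => e; rewrite -[leqLHS]e.
  exact: (leq_bigmax_seq (F := fun a : 'X_{1..m + n} => a (xv i)) a af).
split; first by rewrite /lead_coef_at degE (xE ord_max).
apply/allP => a /supp[j /mnmP aE]; apply/forallP => l; apply/implyP => al.
rewrite inE; case: (split_ordP l) => l' lE.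
  by rewrite lE /is_y codom_f.
rewrite {}lE in al *; have := aE l'; rewrite mnmE mulmnE mnm1E.
case: eqP => [-> _|_ a0]; first by rewrite eqxx orbT.
by rewrite [a _]a0 in al.
Qed.

End LeadingCoefficient.

Section FiniteEtaleLocus.
Variables (k : fieldType) (m n : nat).
Local Notation S := {mpoly k[m + n]}.
Local Notation xv := (@xvar m n).
Local Notation yin := (@yincl k m n).
Local Notation xm a := ('X_[mpush xv a] : S).
Variables (I : ideal S) (t : nat) (g : 'I_t -> S).
Hypothesis Hg : forall f, I f <-> ideal_gen (fun p => exists j, p = g j) f.
Variables (A B : comPzRingType) (F : {rmorphism A -> B}).
Variables (pA : {rmorphism {mpoly k[m]} -> A}) (pB : {rmorphism S -> B}).
Hypothesis FpA : forall c, F (pA c) = pB (yin c).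
Hypothesis pB_surj : forall z, exists p, pB p = z.
Hypothesis pA_surj : forall z, exists c, pA c = z.
Hypothesis pB_eq0 : forall p, pB p = 0 <-> I p.
Hypothesis pA_eq0 : forall p, pA p = 0 <-> I (yin p).
Variables (Tx : rel 'X_{1..n}) (Ty : rel 'X_{1..m}).
Hypotheses (HTx : monomial_order Tx) (HTy : monomial_order Ty).
Variable G : seq S.
Hypothesis HG : groebner (xy_order Tx Ty) I G.
Variables (r : nat) (ms : 'I_r -> 'X_{1..n}).
Variables (T1 : rel 'X_{1..n + 1}) (T2 : rel 'X_{1..r}) (T3 : rel 'X_{1..m}).
Variables (H : seq {mpoly k[m + n + (1 + r)]}).
Variables (s : nat) (N : 'M[{mpoly k[m]}]_(r, s)).
Hypothesis HN : has_pure_powers Tx G -> flat_data I Tx G ms T1 T2 T3 H N.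

Variable P : spec A.
Let KP : ideal {mpoly k[m]} := preim_ideal pA P.
Local Notation e := (fun j => pB (xm (ms j))).
Local Notation NA := (map_mx pA N).

Lemma elim_KP p : I (yin p) -> KP p.
Proof. by move=> /pA_eq0 /= ->; apply: ideal0. Qed.

(** Witness form of [~ VA K P]; see [outside_VA]. *)
Definition outside (K : {mpoly k[m]} -> Prop) := exists2 c, K c & ~ P (pA c).

(** By [finite_integral], a power of [a] times a characteristic polynomial at [a ^+ q * x_i] lies in
    [I]. That polynomial is monic, so the leading coefficient in [x_i] is a power of [a]. *)
Lemma finite_outside_W a i : ~ P (pA a) ->
  module_finite (restr (loc_map F (pA a))) -> outside (nonfinite_ideal I i).
Proof.
move=> nPa /(finite_integral (pB 'X_(xv i)))[d [q [l [C e0]]]].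
have /choice[C0 CE] : forall ij : 'I_d * 'I_d, exists c, pA c = C ij.1 ij.2.
  by move=> ij; apply: pA_surj.
pose M : 'M[{mpoly k[m]}]_d := \matrix_(u, v) C0 (u, v).
have MC : C = map_mx pA M by apply/matrixP => u v; rewrite !mxE CE.
pose x := yin (a ^+ q) * 'X_(xv i).
pose p := char_poly M.
(* The coefficient of [x_i ^ j] after substituting [a ^+ q * x_i] into [p] and multiplying by
   [a ^+ l]. *)
pose u j := a ^+ l * p`_j * a ^+ (q * j).
have psz : size p = d.+1 by apply: size_char_poly.
have detE : \det (x%:M - map_mx yin M) = (map_poly yin p).[x].
  rewrite /p /char_poly -[RHS]/((horner_eval x \o map_poly yin) _) -det_map_mx.
  congr (\det _); apply/matrixP => v v'; rewrite !mxE /= /horner_eval.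
  rewrite rmorphB rmorphMn /= map_polyX map_polyC hornerD hornerN hornerC.
  by rewrite hornerMn hornerX.
pose f := \sum_(j < d.+1) yin (u j) * 'X_(xv i) ^+ j.
have If : I f.
  have -> : f = yin a ^+ l * \det (x%:M - map_mx yin M).
    rewrite detE (@horner_coef_wide _ d.+1); last first.
      by rewrite -psz; apply: size_poly.
    rewrite mulr_sumr; apply: eq_bigr => j _.
    rewrite coef_map /u !rmorphM !rmorphXn /= /x exprMn rmorphXn /= -exprM; ring.
  apply/pB_eq0; rewrite rmorphM rmorphXn /= -FpA -[RHS]e0 MC.
  congr (_ * _); rewrite -det_map_mx map_mxB map_scalar_mx.
  rewrite /x rmorphM rmorphXn /= rmorphXn /= -FpA -!map_mx_comp.
  by congr (\det (_ - _)); apply: eq_map_mx => c /=; rewrite FpA.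
have udE : u d = a ^+ l * a ^+ (q * d).
  have := char_poly_monic M; rewrite monicE lead_coefE psz => /eqP pd.
  by rewrite /u /p pd mulr1.
have nPu : ~ P (pA (u d)).
  by rewrite udE rmorphM !rmorphXn; apply: spec_notM; apply: spec_notX.
have nz : u d != 0.
  by apply/eqP => u0; apply: nPu; rewrite u0 rmorph0; apply: ideal0.
have [lE fv] := lead_coef_at_sum i nz.
by exists (u d) => //; exists f; split.
Qed.

Lemma unramified_outside_jac a : ~ P (pA a) -> unramified (loc_map F (pA a)) ->
  outside (fun f => jac_ideal I g (yin f)).
Proof.
move=> nPa.
move=> /(unramified_jac Hg FpA pB_surj pA_surj pB_eq0)[l Jl].
by exists (a ^+ l) => //; rewrite rmorphXn; apply: spec_notX.
Qed.

(** The condition under which the monomials generate after inverting [b]. It is stable under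
    multiples, so further elements may be inverted. *)
Definition lead_multiple b := forall i, exists g w, g \in pure_powers Tx G i /\
  b = w * xcoef (lead_mon_x Tx g) g.

Lemma lead_multipleM b c : lead_multiple b -> lead_multiple (b * c).
Proof.
move=> lb i; have [g' [w [gG ->]]] := lb i; exists g', (w * c); split=> //.
by rewrite mulrAC.
Qed.

Lemma outside_lead_multiple : (forall i, outside (nonfinite_ideal I i)) ->
  exists2 b, ~ P (pA b) & lead_multiple b.
Proof.
move=> nW.
have /choice[h hP] : forall i, exists h, h \in pure_powers Tx G i /\
    ~ P (pA (xcoef (lead_mon_x Tx h) h)).
  move=> i; have [c Ic nPc] := nW i.
  by have [h hG nh] := locus_pure_power HTx HTy HG (K := KP) elim_KP Ic nPc; exists h.
pose lc i := xcoef (lead_mon_x Tx (h i)) (h i).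
exists (\prod_i lc i).
  by rewrite rmorph_prod; apply: spec_not_prod => i; have [] := hP i.
move=> i; exists (h i), (\prod_(j | j != i) lc j).
by split; [have [] := hP i | rewrite (bigD1 i) //= mulrC].
Qed.

Lemma lead_multiple_pure b : lead_multiple b -> has_pure_powers Tx G.
Proof.
move=> lb i; have [g' [w [gG _]]] := lb i.
by apply: contraTneq gG => ->.
Qed.

Section Presentation.
Hypothesis pure : has_pure_powers Tx G.

Lemma monomials_generate b : lead_multiple b -> generates_at F e (pA b).
Proof.
move=> lb z; have [p <-] := pB_surj z.
have [Hms _ _ _ _] := HN pure.
have [l [c /pB_eq0 cE]] := reducible_all HTx HG Hms lb p.
exists l, (fun j => pA (c j)).
move: cE; rewrite rmorphB rmorphM rmorphXn /= -FpA rmorph_sum => /subr0_eq ->.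
by apply: eq_bigr => j _; rewrite rmorphM /= FpA.
Qed.

Lemma monomial_relations (c : 'cV[A]_r) : \sum_j F (c j 0) * e j = 0 ->
  exists v, c = NA *m v.
Proof.
have /choice[c0 cE] : forall j, exists c0, pA c0 = c j 0.
  by move=> j; apply: pA_surj.
have -> : \sum_j F (c j 0) * e j = pB (\sum_j yin (c0 j) * xm (ms j)).
  by rewrite rmorph_sum; apply: eq_bigr => j _; rewrite rmorphM /= -FpA cE.
move=> /pB_eq0 Ic.
have [_ [T1_ok T2_ok T3_ok _] HH Hhom Hrel] := HN pure.
have [v vE] := relation_matrix_complete T1_ok T2_ok T3_ok HH Hhom Hrel Ic.
exists (\col_q pA (v q)); apply/matrixP => j i; rewrite ord1 !mxE -cE.
have /pA_eq0 := vE j; rewrite rmorphB rmorph_sum => /subr0_eq ->.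
by apply: eq_bigr => q _; rewrite !mxE rmorphM.
Qed.

Lemma matrix_relations q : \sum_j F (NA j q) * e j = 0.
Proof.
have [_ _ HH _ Hrel] := HN pure.
have /pB_eq0 := relation_matrix_sound HH Hrel q.
rewrite rmorph_sum => h0; rewrite -[RHS]h0; apply: eq_bigr => j _.
by rewrite mxE rmorphM /= FpA.
Qed.

Lemma minors_lift j x : minors NA j x -> exists2 y, minors N j y & x = pA y.
Proof.
move=> [f [f' [fh fh' ->]]]; exists (\det (mxsub f f' N)); first by exists f, f'.
by rewrite -map_mxsub det_map_mx.
Qed.

Lemma minors_map j x : minors N j x -> minors NA j (pA x).
Proof.
by move=> [f [f' [fh fh' ->]]]; exists f, f'; rewrite -map_mxsub det_map_mx.
Qed.

(** Flatness makes [N] regular over [A] up to an element outside [P], and [regular_fitting] returns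
    [f]. Lifted to [k[y]], it lies in [F_i] and in the colon ideal of [F_(i-1)], hence in the
    flatness ideal. *)
Lemma flat_outside_F a b : ~ P (pA a) -> ~ P (pA b) -> lead_multiple b ->
  flat (restr (loc_map F (pA a))) -> outside (flatness_ideal I N).
Proof.
move=> nPa nPb lb fl.
have [q [q' [Y YE]]] := flat_splitting monomial_relations matrix_relations fl
  (monomials_generate lb).
have nPab : ~ P (pA a ^+ q * pA b ^+ q').
  by apply: spec_notM; apply: spec_notX.
have [i [f [ir nPf fgen f0]]] := regular_fitting nPab YE.
have [f1 f1gen f1E] : exists2 f1, fitting_ideal I N i.+1 f1 & f = pA f1.
  have [l [lm ->]] := fgen.
  rewrite big_seq; elim/big_ind: _ => [|x y [x1 xm ->] [y1 ym ->]|p pl].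
  - by exists 0; [apply: ideal_gen0 | rewrite rmorph0].
  - by exists (x1 + y1); [apply: ideal_genD | rewrite rmorphD].
  - have [y my ->] := minors_lift (lm _ pl); have [z <-] := pA_surj p.1.
    exists (z * y); last by rewrite rmorphM.
    by apply: ideal_genM; apply: ideal_gen_incl; right; rewrite subSS.
exists f1; last by rewrite -f1E.
apply: ideal_gen_incl; exists i; split=> // y.
pose K : ideal {mpoly k[m]} := annihilator pA (fun _ : unit => f : A^o).
have Ky : ideal_gen (fun z => elim_ideal I z \/ minors N (r.+1 - i) z) y -> K y.
  apply: ideal_gen_sub => z [/pA_eq0 z0|/minors_map /f0 fz] [] /=.
    by rewrite z0 scale0r.
  by rewrite -[RHS]fz mulrC.
move=> /Ky /(_ tt) /= h; apply/pA_eq0; rewrite rmorphM -f1E -[RHS]h.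
exact: mulrC.
Qed.

End Presentation.

Lemma finite_etale_outside a : ~ P (pA a) -> finite_etale (loc_map F (pA a)) ->
  [/\ forall i, outside (nonfinite_ideal I i),
      has_pure_powers Tx G -> outside (flatness_ideal I N)
    & outside (fun f => jac_ideal I g (yin f))].
Proof.
move=> nPa [fin fl unr].
have nW i : outside (nonfinite_ideal I i) by apply: finite_outside_W fin.
split=> //; last exact: unramified_outside_jac unr.
move=> pure; have [b nPb lb] := outside_lead_multiple nW.
exact: (flat_outside_F pure nPa nPb lb fl).
Qed.

Lemma outside_finite_etale : (forall i, outside (nonfinite_ideal I i)) ->
    (has_pure_powers Tx G -> outside (flatness_ideal I N)) ->
    outside (fun f => jac_ideal I g (yin f)) ->
  exists a, ~ P (pA a) /\ finite_etale (loc_map F (pA a)).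
Proof.
move=> /outside_lead_multiple[b nPb lb] nF [c Jc nPc].
have pure := lead_multiple_pure lb.
have [f0 Ff0 nPf0] := nF pure.
(* If all generators of the flatness ideal were in the prime, so would be the whole ideal. *)
have [f [i [ir fcol ffit nPf]]] : exists f i, [/\ (i <= r)%N,
    colon (elim_ideal I) (fitting_ideal I N i) f, fitting_ideal I N i.+1 f
    & ~ P (pA f)].
  apply: contrapT => nf; apply: nPf0.
  apply: (@ideal_gen_sub _ KP) Ff0 => z [i [ir zc zf]].
  by apply: contrapT => nPz; apply: nf; exists z, i.
(* [f] lies in [F_i] and [J] maps into [P], so a minor of order [r - i] avoids [P]. *)
have [D mD nPD] : exists2 D, minors N (r - i) D & ~ P (pA D).
  apply: contrapT => nD; apply: nPf.
  apply: (@ideal_gen_sub _ KP) ffit => z [/elim_KP //|]; rewrite subSS => mz.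
  by apply: contrapT => nPz; apply: nD; exists z.
(* Inverting [b] gives generation and [c] unramifiedness; inverting [D] and [f] splits the
   presentation. *)
pose a := b * c * D * f; exists a; split.
  by rewrite !rmorphM; do 3!apply: spec_notM => //.
have lba : lead_multiple a by do 3!apply: lead_multipleM.
have gen := monomials_generate pure lba.
split.
- exact: generates_module_finite gen.
- have [u [v [_ _ DE]]] := mD.
  have fN x : minors NA (r - i).+1 x -> pA f * x = 0.
    move=> /minors_lift[y my ->]; rewrite -rmorphM; apply/pA_eq0/fcol.
    by apply: ideal_gen_incl; right; rewrite subSn.
  have [E [X [EN EX]]] := fitting_schur u v fN.
  have DA : \det (mxsub u v NA) = pA D by rewrite -map_mxsub det_map_mx DE.
  rewrite DA in EN EX.
  apply: (splitting_flat (monomial_relations pure) (matrix_relations pure)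
    (E := E) (X := X) (D := pA D) (w := pA (b * c * f)) (l := (r - i).+1) gen) => //.
    have -> : pA a ^+ (r - i).+1 = pA (b * c * D) * pA (b * c * f) ^+ (r - i) *
        (pA f * pA D ^+ (r - i)).
      rewrite exprS /a -!rmorphXn -!rmorphM; congr (pA _).
      by rewrite !exprMn; ring.
    by rewrite -scalerA EN scaler0.
  by rewrite -rmorphM; congr (pA _); rewrite /a; ring.
- apply: (jac_unramified Hg FpA pB_surj pB_eq0 (c := c) (w := b * D * f)) => //.
  by rewrite /a; ring.
Qed.

End FiniteEtaleLocus.

(** * The quotient rings and the conclusion *)

Section Presentations.
Variables (k : fieldType) (m n : nat) (I : ideal {mpoly k[m + n]}).

Definition piA : {mpoly k[m]} -> ringA I := quot_pi (elim_ideal I).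
HB.instance Definition _ := GRing.RMorphism.on piA.
Definition piB : {mpoly k[m + n]} -> ringB I := quot_pi I.
HB.instance Definition _ := GRing.RMorphism.on piB.

Lemma structure_map_piA c : structure_map I (piA c) = piB (yincl n c).
Proof. exact: quot_mapE. Qed.

Lemma piA_surj z : exists c, piA c = z.
Proof. by exists (repr z); apply: quot_piK. Qed.

Lemma piB_surj z : exists p, piB p = z.
Proof. by exists (repr z); apply: quot_piK. Qed.

Lemma piA_eq0 c : piA c = 0 <-> I (yincl n c).
Proof. exact: (quot_pi_eq0 (elim_ideal I)). Qed.

Lemma piB_eq0 p : piB p = 0 <-> I p.
Proof. exact: quot_pi_eq0. Qed.

Lemma outside_VA (K : {mpoly k[m]} -> Prop) (P : spec (ringA I)) :
  outside piA P K <-> ~ VA K P.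
Proof.
split=> [[c Kc nPc] h|nV]; first by apply: nPc; apply: h; exists c.
apply: contrapT => nK; apply: nV => _ [c Kc ->]; apply: contrapT => nPc.
by apply: nK; exists c.
Qed.

End Presentations.

Theorem theorem5p8 (k : fieldType) (m n : nat) (I : ideal {mpoly k[m + n]})
    (t : nat) (g : 'I_t -> {mpoly k[m + n]})
    (Hg : forall f, I f <-> ideal_gen (fun p => exists j, p = g j) f)
    (Tx : rel 'X_{1..n}) (Ty : rel 'X_{1..m})
    (HTx : monomial_order Tx) (HTy : monomial_order Ty)
    (G : seq {mpoly k[m + n]}) (HG : groebner (xy_order Tx Ty) I G)
    (r : nat) (ms : 'I_r -> 'X_{1..n})
    (T1 : rel 'X_{1..n + 1}) (T2 : rel 'X_{1..r}) (T3 : rel 'X_{1..m})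
    (H : seq {mpoly k[m + n + (1 + r)]})
    (s : nat) (N : 'M[{mpoly k[m]}]_(r, s))
    (HN : has_pure_powers Tx G -> flat_data I Tx G ms T1 T2 T3 H N) :
  is_largest_open (finite_etale_over (structure_map I))
    (fun P => ~ [\/ nonfinite_locus P, flatness_locus Tx G N P
                  | jac_locus g P]).
Proof.
set U := fun P => _.
have etale_U (Q : spec (ringA I)) a : ~ Q a ->
    finite_etale (loc_map (structure_map I) a) -> U Q.
  have [c <-] := piA_surj a => nQ et.
  have [nW nF nJ] := finite_etale_outside Hg (structure_map_piA I)
    (piB_surj (I := I)) (piA_surj (I := I)) (piB_eq0 I) (piA_eq0 I) HTx HTy HG
    HN nQ et.
  case=> [[i]|[pure]|].
  - exact/outside_VA/nW.
  - exact/outside_VA/(nF pure).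
  - exact/outside_VA/nJ.
have U_etale (Q : spec (ringA I)) : U Q -> exists a,
    ~ Q a /\ finite_etale (loc_map (structure_map I) a).
  move=> UQ.
  have [|pure||a [nQ et]] := outside_finite_etale Hg (structure_map_piA I)
    (piB_surj (I := I)) (piA_surj (I := I)) (piB_eq0 I) (piA_eq0 I) HTx HTy HG
    HN (P := Q); last by exists (piA I a).
  - by move=> i; apply/outside_VA => WQ; apply: UQ; constructor 1; exists i.
  - by apply/outside_VA => FQ; apply: UQ; constructor 2.
  - by apply/outside_VA => JQ; apply: UQ; constructor 3.
have etale_over : finite_etale_over (structure_map I) U.
  move=> Q /U_etale[a [nQ et]]; exists a; split=> // Q' nQ'.
  exact: etale_U nQ' et.
split=> //.
(* [U] is open as the union of the basic open sets that it contains. *)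
- exists (fun a => forall Q : spec (ringA I), ~ Q a -> U Q) => Q; split.
    by move=> /etale_over[a [nQ aU _]] h; apply/nQ/h.
  move=> nz; apply: contrapT => nU; apply: nz => a aU; apply: contrapT => nQ.
  exact/nU/aU.
- by move=> U' _ etU' Q /etU'[a [nQ _ et]]; apply: etale_U nQ et.
Qed.
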